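(* Let $1<p<\infty$ and $1<q<\infty$. The space $C_0$ of compactly supported continuous functions on $\mathbb{R}^n$ is dense in both $B^{p,q}$ and $N^{p,q}$.
   Context: Fix $n\in\mathbb{N}$, $0<\alpha<\infty$, $1<s\le n/\alpha$. Let $G_\alpha=\mathcal{F}^{-1}[(1+|\cdot|^2)^{-\alpha/2}]$ be the Bessel kernel on $\mathbb{R}^n$. For $E\subseteq\mathbb{R}^n$ the Bessel capacity is $\mathcal{C}(E)=\inf\{\|f\|_{L^s(\mathbb{R}^n)}^s: f\ge 0,\ G_\alpha\ast f\ge 1\text{ on }E\}$. $\mathcal{M}(\mathbb{R}^n)$ is the set of extended real-valued Lebesgue measurable functions on $\mathbb{R}^n$. For $0<p,q<\infty$, $\|f\|_{L^{p,q}}=p^{1/q}\left(\int_0^\infty |\{|f|>t\}|^{q/p}t^q\frac{dt}{t}\right)^{1/q}$. Write $q'=q/(q-1)$. Block spaces: $b\in\mathcal{M}(\mathbb{R}^n)$ is a $B^{p,q}$ block if there is a bounded set $E\subseteq\mathbb{R}^n$ with $\{b\ne0\}\subseteq E$ and $\mathcal{C}(E)^{1/q'}\|b\|_{L^{p,q}}\le1$. $B^{p,q}$ is the set of $f\in\mathcal{M}(\mathbb{R}^n)$ with a decomposition $f=\sum_k\lambda_k b_k$ (countable sum, pointwise a.e. convergent), $\{\lambda_k\}\in\ell^1$, each $b_k$ a $B^{p,q}$ block; $\|f\|_{B^{p,q}}=\inf\sum_k|\lambda_k|$ over all such decompositions. Weights: for a nonnegative function $\omega$ on $\mathbb{R}^n$,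 $\|\omega\|_{L^1(\mathcal{C})}=\int_0^\infty\mathcal{C}(\{\omega>t\})\,dt$, and $L^1(\mathcal C)$ is the set of $\omega$ for which this is finite. A weight is a nonnegative, locally integrable function $\omega$ with $\omega>0$ a.e. The local maximal function is $\mathbf{M}^{\rm loc}f(x)=\sup_{0<r\le1}\frac{1}{|B_r(x)|}\int_{B_r(x)}|f|\,dy$. $A_1^{\rm loc}$ is the class of weights with $\mathbf{M}^{\rm loc}\omega\le C\omega$ a.e. for some constant $C>0$; $[\omega]_{A_1^{\rm loc}}$ is the infimum of such $C$. The constant $\mathfrak{c}$: for $E\subseteq\mathbb{R}^n$ with $0<\mathcal{C}(E)<\infty$, let $\mu=\mu^E$ be the capacitary measure of $E$ (a positive measure supported in $\overline{E}$ such that $V^E=G_\alpha\ast(G_\alpha\ast\mu)^{s'-1}$, $s'=s/(s-1)$, satisfies $V^E\ge1$ on $E$ outside a set of capacity zero, $V^E\le1$ on ${\rm supp}(\mu)$, and $\mu(\mathbb{R}^n)=\int(G_\alpha\ast\mu)^{s'}dx=\int V^Ed\mu=\mathcal{C}(E)$). It is known that there are positive constants $\delta,\mathfrak{c},C$ depending only on $n,\alpha,s$ such that for all such $E$: $(V^E)^\delta\in L^1(\mathcal C)\cap A_1^{\rm loc}$, $C^{-1}\mathcal{C}(E)\le\|(V^E)^\delta\|_{L^1(\mathcal{C})}\le C\,\mathcal{C}(E)$ and $[(V^E)^\delta]_{A_1^{\rm loc}}\le\mathfrak{c}$. Fix this $\mathfrak{c}$. $N^{p,q}$ ($1<p,q<\infty$)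 is the set of $f\in\mathcal{M}(\mathbb{R}^n)$ with $$\|f\|_{N^{p,q}}=\inf\{\|f\omega^{-1/q'}\|_{L^{p,q}}:\omega\in L^1(\mathcal{C})\cap A_1^{\rm loc},\ \|\omega\|_{L^1(\mathcal{C})}\le1,\ [\omega]_{A_1^{\rm loc}}\le\mathfrak{c}\}<\infty.$$ *)

(* Defs.v *)
From HB Require Import structures.
From mathcomp Require Import all_boot all_order all_algebra.
From mathcomp Require Import all_classical all_reals all_analysis.
From mathcomp Require Import measurable_realfun.

Set Implicit Arguments.
Unset Strict Implicit.
Unset Printing Implicit Defensive.

Import Order.TTheory GRing.Theory Num.Theory.
Import numFieldNormedType.Exports.

Local Open Scope classical_set_scope.
Local Open Scope ring_scope.
Local Open Scope ereal_scope.

(* R^n is 'rV[R]_n with its library topology.  The library norm on row vectors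
   is the sup norm, hence the separate Euclidean norm and Euclidean balls. *)

Section euclidean_space.
Context {R : realType} {n : nat}.
Local Notation Rn := 'rV[R]_n.

Definition edot (x y : Rn) : R := (\sum_(i < n) x 0 i * y 0 i)%R.

Definition enorm (x : Rn) : R := Num.sqrt (edot x x).

Definition eball (x : Rn) (r : R) : set Rn := [set y | (enorm (y - x) < r)%R].

Definition box (a b : Rn) : set Rn :=
  [set x | forall i, (a 0 i < x 0 i <= b 0 i)%R].

Definition boxes : set (set Rn) := [set A | exists a b, A = box a b].

(* The corners of a nonempty box are unique, so the infimum is over one point;
   it is +oo when A is not a box.  The empty set is singled out because of
   boxes with reversed corners. *)
Definition box_volume (A : set Rn) : \bar R :=
  if `[< A = set0 >] then 0 else
  ereal_inf [set v | exists a b, A = box a b /\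
                       v = (\prod_(i < n) (b 0 i - a 0 i))%:E].

(* infimum of the total volume of countable covers by boxes *)
Definition lebesgue_outer : set Rn -> \bar R :=
  @mu_ext _ (g_sigma_algebraType boxes) R box_volume.

Lemma box_volume0 : box_volume set0 = 0.
Proof. by rewrite /box_volume; case: asboolP. Qed.

Lemma box_volume_ge0 A : 0 <= box_volume A.
Proof.
rewrite /box_volume; case: asboolP => // A0.
apply: le_ereal_inf_tmp => _ [a [b [Aab ->]]].
have [x Ax] : A !=set0 by exact/set0P/eqP.
rewrite lee_fin; apply: prodr_ge0 => i _; rewrite subr_ge0.
move: Ax; rewrite Aab => /(_ i) /andP[/ltW axi xib].
exact: le_trans axi xib.
Qed.

HB.instance Definition _ := isOuterMeasure.Build R Rn lebesgue_outer
  (@mu_ext0 _ (g_sigma_algebraType boxes) R _ box_volume0 box_volume_ge0)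
  (@mu_ext_ge0 _ (g_sigma_algebraType boxes) R _ box_volume_ge0)
  (@le_mu_ext _ (g_sigma_algebraType boxes) R _)
  (@mu_ext_sigma_subadditive _ (g_sigma_algebraType boxes) R _ box_volume_ge0).

End euclidean_space.

(* R^n with the Lebesgue (complete) sigma-algebra, i.e. the sets that are
   Caratheodory-measurable for the Lebesgue outer measure. *)
Definition leb_space (R : realType) (n : nat) : Type :=
  caratheodory_type (@lebesgue_outer R n).
HB.instance Definition _ (R : realType) (n : nat) :=
  Measurable.on (leb_space R n).

Definition lebn {R : realType} {n : nat} : set (leb_space R n) -> \bar R :=
  @lebesgue_outer R n.
HB.instance Definition _ (R : realType) (n : nat) :=
  Measure.copy (@lebn R n)
    ([the {outer_measure set 'rV[R]_n -> \bar R} of @lebesgue_outer R n]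
       : set (caratheodory_type (@lebesgue_outer R n)) -> \bar R).

(* R^n with the Borel sigma-algebra. *)
Definition borel_space (R : realType) (n : nat) : Type :=
  g_sigma_algebraType (@open 'rV[R]_n).
HB.instance Definition _ (R : realType) (n : nat) :=
  Measurable.on (borel_space R n).

Section function_spaces.
Context {R : realType} {n : nat}.
Local Notation Rn := 'rV[R]_n.
Local Notation Leb := (leb_space R n).
Local Notation Bor := (borel_space R n).
Local Notation lambda := (@lebn R n).

Definition lebesgue_measurable (f : Rn -> \bar R) :=
  measurable_fun [set: Leb] (f : Leb -> \bar R).

(* G is an integrable function whose Fourier transform
   xi |-> \int G(x) e^{- i x.xi} dx is (1 + |xi|^2)^(- alpha / 2); the two
   integrals are the real part and minus the imaginary part.  This determines
   G almost everywhere, and the potentials below do not depend on the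
   representative, which is taken Borel so that it can be integrated against
   Borel measures. *)
Definition is_bessel_kernel (alpha : R) (G : Rn -> R) :=
  [/\ measurable_fun [set: Bor] (G : Bor -> R),
      lambda.-integrable [set: Leb] (fun x => (G x)%:E) &
      forall xi : Rn,
        \int[lambda]_x (G x * cos (edot x xi))%:E
          = ((1 + enorm xi ^+ 2) `^ (- (alpha / 2)))%:E /\
        \int[lambda]_x (G x * sin (edot x xi))%:E = 0].

Definition convol (G : Rn -> R) (f : Rn -> \bar R) (x : Rn) : \bar R :=
  \int[lambda]_y ((G (x - y))%:E * f y).

Definition convolm (G : Rn -> R) (mu : {measure set Bor -> \bar R}) (x : Rn) :
    \bar R :=
  \int[mu]_y (G (x - y))%:E.

Definition capacity (G : Rn -> R) (s : R) (E : set Rn) : \bar R :=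
  ereal_inf [set 'N[lambda]_s%:E[f] `^ s | f in
    [set f : Leb -> \bar R | [/\ lebesgue_measurable f, (forall x, 0 <= f x) &
                                forall x, E x -> 1 <= convol G f x]]].

(* the conjugate exponent r / (r - 1) *)
Definition conjexp (r : R) : R := (r / (r - 1))%R.

Definition lorentz (p q : R) (f : Rn -> \bar R) : \bar R :=
  (p `^ q^-1)%:E *
  (\int[lebesgue_measure]_(t in `]0%R, +oo[)
     (lambda [set x | t%:E < `|f x|] `^ (q / p) * (t `^ q / t)%:E)) `^ q^-1.

Definition cap_norm (G : Rn -> R) (s : R) (w : Rn -> \bar R) : \bar R :=
  \int[lebesgue_measure]_(t in `]0%R, +oo[) capacity G s [set x | t%:E < w x].

Definition in_L1cap (G : Rn -> R) (s : R) (w : Rn -> \bar R) :=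
  (forall x, 0 <= w x) /\ cap_norm G s w < +oo.

Definition is_weight (w : Rn -> \bar R) :=
  [/\ lebesgue_measurable w, (forall x, 0 <= w x),
      (forall K : set Rn, compact K -> \int[lambda]_(x in K) w x < +oo) &
      {ae lambda, forall x, 0 < w x}].

Definition local_maximal (f : Rn -> \bar R) (x : Rn) : \bar R :=
  ereal_sup [set ((fine (lambda (eball x r)))^-1)%:E *
                 \int[lambda]_(y in eball x r) `|f y| | r in `]0%R, 1%R]].

Definition A1loc_bound (w : Rn -> \bar R) (C : R) :=
  (0 < C)%R /\ {ae lambda, forall x, local_maximal w x <= C%:E * w x}.

Definition in_A1loc (w : Rn -> \bar R) :=
  is_weight w /\ exists C, A1loc_bound w C.

Definition A1loc_const (w : Rn -> \bar R) : \bar R :=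
  ereal_inf [set C%:E | C in A1loc_bound w].

Definition measure_support (mu : {measure set Bor -> \bar R}) : set Rn :=
  [set x | forall U : set Rn, open U -> U x -> 0 < mu U].

(* V = G * (G * mu)^(s' - 1) *)
Definition potential (G : Rn -> R) (s : R) (mu : {measure set Bor -> \bar R}) :
    Rn -> \bar R :=
  convol G (fun y => convolm G mu y `^ (conjexp s - 1)).

Definition is_capacitary_measure (G : Rn -> R) (s : R) (E : set Rn)
    (mu : {measure set Bor -> \bar R}) :=
  let V := potential G s mu in
  [/\ measure_support mu `<=` closure E,
      (exists2 Z : set Rn, capacity G s Z = 0 &
         forall x, E x -> ~ Z x -> 1 <= V x),
      (forall x, measure_support mu x -> V x <= 1) &
      [/\ mu [set: Bor] = capacity G s E,
          \int[lambda]_x (convolm G mu x `^ conjexp s) = capacity G s E &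
          \int[mu]_x V x = capacity G s E]].

(* c bounds the local A_1 constant of (V^E)^delta, uniformly over all sets E
   of positive finite capacity, where V^E is the potential of the (unique)
   capacitary measure of E. *)
Definition is_A1loc_constant (G : Rn -> R) (s c : R) :=
  (0 < c)%R /\ exists delta C : R, [/\ (0 < delta)%R, (0 < C)%R &
    forall E : set Rn, 0 < capacity G s E < +oo ->
    exists2 mu : {measure set Bor -> \bar R}, is_capacitary_measure G s E mu &
      let W := fun x => potential G s mu x `^ delta in
      [/\ in_L1cap G s W, in_A1loc W,
          C^-1%:E * capacity G s E <= cap_norm G s W <= C%:E * capacity G s E &
          A1loc_const W <= c%:E]].

Definition is_block (G : Rn -> R) (s p q : R) (b : Rn -> \bar R) :=
  lebesgue_measurable b /\
  exists E : set Rn, [/\ bounded_set E, [set x | b x != 0] `<=` E &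
    capacity G s E `^ (conjexp q)^-1 * lorentz p q b <= 1].

(* The series converges to a finite limit, so in particular its terms are
   finite, almost everywhere. *)
Definition block_decomposition (G : Rn -> R) (s p q : R) (f : Rn -> \bar R)
    (l : nat -> R) (b : nat -> Rn -> \bar R) :=
  [/\ \sum_(0 <= k <oo) `|l k|%:E < +oo,
      (forall k, is_block G s p q (b k)) &
      {ae lambda, forall x, f x \is a fin_num /\
        (fun m => \sum_(0 <= k < m) (l k)%:E * b k x) @ \oo --> f x}].

Definition block_norm (G : Rn -> R) (s p q : R) (f : Rn -> \bar R) : \bar R :=
  ereal_inf [set v | exists l b, block_decomposition G s p q f l b /\
                       v = \sum_(0 <= k <oo) `|l k|%:E].

Definition block_space (G : Rn -> R) (s p q : R) : set (Rn -> \bar R) :=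
  [set f | lebesgue_measurable f /\
           exists l b, block_decomposition G s p q f l b].

(* A weight is positive and finite a.e., so the conventions for negative powers
   of 0 and +oo play no role. *)
Definition N_norm (G : Rn -> R) (s c p q : R) (f : Rn -> \bar R) : \bar R :=
  ereal_inf [set lorentz p q (fun x => f x * w x `^ (- (conjexp q)^-1)) | w in
    [set w | [/\ in_L1cap G s w, in_A1loc w, cap_norm G s w <= 1 &
                 A1loc_const w <= c%:E]]].

Definition N_space (G : Rn -> R) (s c p q : R) : set (Rn -> \bar R) :=
  [set f | lebesgue_measurable f /\ N_norm G s c p q f < +oo].

Definition Cc : set (Rn -> R) :=
  [set g | continuous g /\ compact (closure [set x | g x != 0%R])].

Definition Cc_dense (X : set (Rn -> \bar R)) (nrm : (Rn -> \bar R) -> \bar R) :=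
  (forall g, Cc g -> X (EFin \o g)) /\
  (forall f, X f -> forall e : R, (0 < e)%R ->
     exists2 g, Cc g & nrm (fun x => f x - (g x)%:E) < e%:E).

End function_spaces.

(* Main.v *)
Require Import Defs.
From HB Require Import structures.
From mathcomp Require Import all_boot all_order all_algebra.
From mathcomp Require Import all_classical all_reals all_analysis.
From mathcomp Require Import measurable_realfun.
From mathcomp Require Import ring lra.
Import Order.TTheory GRing.Theory Num.Theory.
Import numFieldNormedType.Exports.
Local Open Scope ring_scope.

Set Implicit Arguments.
Unset Strict Implicit.
Unset Printing Implicit Defensive.

(**
In both spaces the task reduces to the Lorentz space L^{p,q}: a function of
L^{p,q} is truncated (dominated convergence for its distribution function), and
a bounded measurable function of bounded support is approximated by layers of
indicators, hence, by outer regularity of Lebesgue measure, by functions of C_0.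

- Blocks.  Bounded sets have finite capacity, since G is integrable with
  integral 1, so a function supported in a fixed ball with small L^{p,q}
  (quasi-)norm is a small multiple of a block.  Hence each block is a limit of
  C_0 functions in B^{p,q}, and the tail of the decomposition of f is small.
  Blocks supported on sets of capacity 0 vanish a.e., because Lebesgue measure
  is dominated by capacity.
- N^{p,q}.  A local A_1 weight is bounded below a.e. on bounded sets, so the
  weighted quasi-norm is dominated there by the unweighted one, and the
  approximation of f is carried out with a single weight.  That C_0 is contained
  in N^{p,q} is witnessed by a multiple of (V^E)^delta for a large ball E.
*)

Local Open Scope classical_set_scope.
Local Open Scope ereal_scope.

(** Two constraints shape the approximation. The functional [lorentz_int] obeys the triangle
    inequality only up to a constant, so inside L^{p,q} only finitely many errors are ever added;
    infinite sums are left to the l^1 coefficients of a block decomposition. And once a function is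
    truncated, its approximants of all accuracies vanish off one common ball: the capacity of that
    ball is a fixed factor between Lorentz norm and block norm, and on it a single lower bound of
    the weight holds. Both capacity estimates rest on the mass of the kernel: its integral, read off
    the Fourier transform at frequency 0, and the L^1 norm of |G|, because the sign of [G] is not
    given. Convolution calls for the maps y -> x - y, hence the invariance of Lebesgue measure is
    proved for reflections. *)

Lemma continuous_prodD (R : realType) (I : finType) (P : pred I) (d : I -> R) :
  continuous (fun t : R => \prod_(i | P i) (d i + t))%R.
Proof.
have -> : (fun t : R => \prod_(i | P i) (d i + t))%R =
          horner (\prod_(i | P i) ('X + (d i)%:P))%R.
  apply/funext => t; rewrite horner_prod; apply: eq_bigr => i _.
  by rewrite hornerD hornerX hornerC addrC.
exact: continuous_horner.
Qed.

(** Half-open boxes are neither open nor stable under reflection. Both defects are repaired by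
    lengthening every side by [t], and the volume, a polynomial in [t], is continuous at 0. *)
Lemma prodD_small (R : realType) (n : nat) (d : 'I_n -> R) (eta : R) :
  (0 < eta)%R ->
  exists2 t : R, (0 < t)%R & (\prod_i (d i + t) <= \prod_i d i + eta)%R.
Proof.
move=> eta0.
have /cvgrPdist_le/(_ _ eta0)/nbhs_ballP[t /= t0 h] :=
  @continuous_prodD R _ xpredT d 0%R.
exists (t / 2)%R; first by rewrite divr_gt0.
have : ball (0%R : R) t (t / 2)%R.
  rewrite /ball /= sub0r normrN ger0_norm ?divr_ge0 ?(ltW t0)//.
  by rewrite ltr_pdivrMr// ltr_pMr// ltr1n.
move=> /h; under eq_bigr do rewrite addr0.
by rewrite distrC ler_distl => /andP[_].
Qed.

(** * Lebesgue outer measure: boxes, reflections, half-spaces *)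

Section lebesgue_rn.
Context {R : realType} {n : nat}.
Local Notation Rn := 'rV[R]_n.
Local Notation Leb := (leb_space R n).
Local Notation Bor := (borel_space R n).
Local Notation lambda := (@lebn R n).

Lemma box_volume_box (a b : Rn) : (forall i, (a 0 i <= b 0 i)%R) ->
  box_volume (box a b) <= (\prod_(i < n) (b 0 i - a 0 i))%:E.
Proof.
move=> ab; rewrite /box_volume; case: asboolP => _.
  by rewrite lee_fin; apply: prodr_ge0 => i _; rewrite subr_ge0.
by apply: ereal_inf_lbound; exists a, b.
Qed.

Lemma boxes_measurable (a b : Rn) :
  @measurable _ (g_sigma_algebraType (@boxes R n)) (box a b).
Proof. by apply: sub_sigma_algebra; exists a, b. Qed.

Lemma lebesgue_outer_volume (F : set Rn) :
  @measurable _ (g_sigma_algebraType (@boxes R n)) F ->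
  lebesgue_outer F <= box_volume F.
Proof.
move=> mF.
apply: ereal_inf_lbound; exists (fun k : nat => if k is 0%N return set Rn then F else set0).
  by split=> [[]// _|t Xt]; exists 0%N.
apply/cvg_lim => //; rewrite -cvg_shiftS.
rewrite (_ : [sequence _]_n = cst (box_volume F)); first exact: cvg_cst.
rewrite funeqE => k /=; rewrite big_nat_recl//= big1 ?adde0// => i _.
exact: box_volume0.
Qed.

Lemma lebesgue_outer_box (a b : Rn) : (forall i, (a 0 i <= b 0 i)%R) ->
  lebesgue_outer (box a b) <= (\prod_(i < n) (b 0 i - a 0 i))%:E.
Proof.
by move=> ab; apply: le_trans (box_volume_box ab);
  apply: lebesgue_outer_volume; exact: boxes_measurable.
Qed.

(** On a set that is not a box, [box_volume] is the infimum of the empty set, +oo, so a lower bound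
    has to be checked only on boxes with ordered corners and on the empty set. *)
Lemma le_box_volume (F : set Rn) (v : \bar R) : 0 <= v ->
  (forall a b : Rn, F = box a b -> (forall i, (a 0 i <= b 0 i)%R) ->
     F !=set0 -> v <= (\prod_(i < n) (b 0 i - a 0 i))%:E) ->
  (F = set0 -> v <= 0) ->
  v <= box_volume F.
Proof.
move=> v0 h h0; rewrite /box_volume; case: asboolP => [//|/eqP/set0P F0].
apply: le_ereal_inf_tmp => _ [a [b [Fab ->]]]; apply: h => // i.
case: F0 => x; rewrite Fab => /(_ i)/andP[/ltW]; exact: le_trans.
Qed.

(** Covers by boxes pull back along [T], and countable subadditivity passes the estimate from boxes
    to all sets. *)
Lemma lebesgue_outer_preimage (T : Rn -> Rn) :
  (forall a b : Rn, (forall i, (a 0 i <= b 0 i)%R) ->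
     lebesgue_outer (T @^-1` box a b) <= (\prod_(i < n) (b 0 i - a 0 i))%:E) ->
  forall A, lebesgue_outer (T @^-1` A) <= lebesgue_outer A.
Proof.
move=> h A; apply: le_ereal_inf_tmp => _ [F [mF AF] <-].
have : T @^-1` A `<=` \bigcup_k (T @^-1` F k).
  by move=> x /AF[k _ Fk]; exists k.
move=> /(le_outer_measure (@lebesgue_outer R n))/le_trans; apply.
apply: le_trans (outer_measure_sigma_subadditive _ _) _.
apply: lee_nneseries => // k _.
apply: le_box_volume; first exact: outer_measure_ge0.
  by move=> a b -> ab _; exact: h.
by move=> ->; rewrite preimage_set0 outer_measure0.
Qed.

Lemma lebesgue_outer_reflect_le (x : Rn) A :
  lebesgue_outer ((fun y => x - y)%R @^-1` A) <= lebesgue_outer A.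
Proof.
apply: lebesgue_outer_preimage => a b ab.
apply/lee_addgt0Pr => eta eta0.
have [t t0 ht] := prodD_small (fun i => (b 0 i - a 0 i)%R) eta0.
pose a' : Rn := (\row_i (x 0 i - b 0 i - t))%R.
pose b' : Rn := (\row_i (x 0 i - a 0 i))%R.
have sub : (fun y : Rn => x - y)%R @^-1` box a b `<=` box a' b'.
  move=> y /= + i => /(_ i); rewrite !mxE => /andP[h1 h2]; apply/andP; split; lra.
apply: le_trans (le_outer_measure (@lebesgue_outer R n) _ _ sub) _.
apply: le_trans (lebesgue_outer_box _) _.
  by move=> i; rewrite !mxE; have := ab i; lra.
rewrite -EFinD lee_fin; apply: le_trans ht; apply: ler_prod => i _.
by rewrite !mxE; have := ab i => abi; apply/andP; split; lra.
Qed.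

Lemma lebesgue_outer_reflect (x : Rn) A :
  lebesgue_outer ((fun y => x - y)%R @^-1` A) = lebesgue_outer A.
Proof.
apply/eqP; rewrite eq_le lebesgue_outer_reflect_le/=.
(* The reflection is its own inverse, so the inequality for the reflected set is the reverse one. *)
apply: le_trans _ (lebesgue_outer_reflect_le x _).
rewrite le_eqVlt; apply/orP; left; apply/eqP; congr lebesgue_outer.
by apply/seteqP; split => y /=; rewrite subKr.
Qed.

Lemma lebn_bounded (M : R) : lambda [set x | (`|x| <= M)%R] < +oo.
Proof.
pose a : Rn := (\row_i (- `|M| - 1))%R; pose b : Rn := (\row_i `|M|)%R.
have sub : [set x : Rn | (`|x| <= M)%R] `<=` box a b.
  move=> x /= xM i; rewrite !mxE.
  have : (`|x 0 i| <= `|M|)%R.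
    apply: le_trans (le_trans xM (ler_norm _)).
    rewrite [leRHS]mx_normrE; apply/bigmax_geP; right => /=.
    by exists (ord0, i).
  by rewrite ler_norml => /andP[h1 h2]; apply/andP; split; lra.
apply: le_lt_trans (le_outer_measure (@lebesgue_outer R n) _ _ sub) _.
apply: le_lt_trans (lebesgue_outer_box _) (ltry _) => i.
by rewrite !mxE; have := normr_ge0 M; lra.
Qed.

(** Caratheodory's criterion reduces to a single covering box, which the hyperplane cuts into two
    boxes whose volumes add up. *)
Lemma halfspace_measurable (i : 'I_n) (c : R) :
  (@measurable _ Leb) [set x : Rn | (x 0 i <= c)%R].
Proof.
apply: le_caratheodory_measurable => X.
apply: le_ereal_inf_tmp => _ [F [mF XF] <-].
set H := [set x : Rn | _].
have subXF (K : set Rn) : X `&` K `<=` \bigcup_k (F k `&` K).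
  by move=> x [/XF[k _ Fk] Kx]; exists k.
have le1 (K : set Rn) : lebesgue_outer (X `&` K) <=
    \sum_(0 <= k <oo) lebesgue_outer (F k `&` K).
  apply: le_trans (le_outer_measure (@lebesgue_outer R n) _ _ (subXF K)) _.
  exact: outer_measure_sigma_subadditive.
apply: le_trans (leeD (le1 H) (le1 (~` H))) _.
rewrite -nneseriesD => [|k _ _|k _ _]; rewrite ?outer_measure_ge0 //.
apply: lee_nneseries => [k _ _|k _]; first by rewrite adde_ge0 ?outer_measure_ge0.
apply: le_box_volume; first by rewrite adde_ge0 ?outer_measure_ge0.
  move=> a b Fab ab _.
  (* The height [c] clamped to the side [[a_i, b_i]], so that both pieces have ordered corners even
     when the hyperplane misses the box. *)
  pose m := (Num.min (b 0 i) (Num.max (a 0 i) c))%R.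
  pose b' : Rn := (\row_j (if j == i then m else b 0 j))%R.
  pose a' : Rn := (\row_j (if j == i then m else a 0 j))%R.
  have abi := ab i.
  have mb : (m <= b 0 i)%R by rewrite /m ge_min lexx.
  have am : (a 0 i <= m)%R by rewrite /m le_min abi le_max lexx.
  have mc : (m <= Num.max (a 0 i) c)%R by rewrite /m ge_min lexx orbT.
  have s1 : F k `&` H `<=` box a b'.
    move=> x []; rewrite Fab => xab /= xc j; rewrite !mxE.
    have /andP[-> /= xb] := xab j; case: eqP xb => [-> xb|//].
    by rewrite /m le_min xb le_max xc orbT.
  have s2 : F k `&` ~` H `<=` box a' b.
    move=> x []; rewrite Fab => xab /= /negP; rewrite -ltNge => xc j; rewrite !mxE.
    have /andP[xa ->] := xab j; rewrite andbT; case: eqP => [ji|//].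
    rewrite ji; apply: le_lt_trans mc _; rewrite gt_max xc andbT.
    by have /andP[] := xab i.
  apply: le_trans (leeD (le_outer_measure _ _ _ s1) (le_outer_measure _ _ _ s2)) _.
  apply: le_trans (leeD (lebesgue_outer_box _) (lebesgue_outer_box _)) _.
  - by move=> j; rewrite !mxE; case: eqP => [->|].
  - by move=> j; rewrite !mxE; case: eqP => [->|].
  rewrite -EFinD lee_fin (bigD1 i)//= [X in (_ + X <= _)%R](bigD1 i)//=.
  rewrite [leRHS](bigD1 i)//= !mxE eqxx.
  rewrite (eq_bigr (fun j => b 0 j - a 0 j)%R); last first.
    by move=> j /negPf ji; rewrite !mxE ji.
  rewrite [X in (_ + _ * X <= _)%R](eq_bigr (fun j => b 0 j - a 0 j)%R); last first.
    by move=> j /negPf ji; rewrite !mxE ji.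
  by rewrite -mulrDl addrC addrA subrK.
by move=> ->; rewrite !set0I !outer_measure0 adde0.
Qed.

End lebesgue_rn.

(** * Lebesgue measurability of open and Borel sets *)

Section lebesgue_rn_topology.
Context {R : realType} {n : nat}.
Local Notation Rn := 'rV[R]_n.
Local Notation Leb := (leb_space R n).
Local Notation Bor := (borel_space R n).
Local Notation lambda := (@lebn R n).

Lemma measurable_coord (i : 'I_n) :
  measurable_fun [set: Leb] ((fun x : Rn => (x 0 i)%R : R) : Leb -> R).
Proof.
apply: (measurability _ (RGenInftyO.measurableE R)).
move=> _ [_ [a ->] <-]; rewrite setTI.
have -> : (fun x : Rn => (x 0 i)%R) @^-1` `]-oo, a[ =
    \bigcup_k [set x : Rn | (x 0 i <= a - k.+1%:R^-1)%R].
  apply/seteqP; split => x /=; rewrite in_itv/=.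
    rewrite -subr_gt0 => /ltr_add_invr[k hk]; exists k => //=.
    by rewrite add0r in hk; rewrite lerBrDr addrC -lerBrDr ltW.
  by move=> [k _ /=]; move=> /le_lt_trans; apply; rewrite ltrBlDr ltrDl.
by apply: bigcupT_measurable => k; exact: halfspace_measurable.
Qed.

Lemma cube_measurable (a : Rn) (r : R) :
  (@measurable _ Leb) [set x : Rn | forall i, (`|x 0 i - a 0 i| < r)%R].
Proof.
have -> : [set x : Rn | forall i, (`|x 0 i - a 0 i| < r)%R] =
   \bigcap_(i in [set: 'I_n]) [set x : Rn | (`|x 0 i - a 0 i| < r)%R].
  by apply/seteqP; split => x /= h i; [move=> _; exact: h|exact: h].
apply: fin_bigcap_measurable => // i _.
have -> : [set x : Rn | (`|x 0 i - a 0 i| < r)%R] =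
    [set: Leb] `&` (fun x : Rn => (x 0 i)%R) @^-1` `](a 0 i - r)%R, (a 0 i + r)%R[.
  by rewrite setTI; apply/seteqP; split => x /=; rewrite in_itv/= ltr_distl.
exact: (@measurable_coord i measurableT _ (measurable_itv _)).
Qed.

Lemma coord_norm_lt (x : Rn) (r : R) : (0 < r)%R ->
  (`|x| < r)%R <-> forall i, (`|x 0 i| < r)%R.
Proof.
move=> r0; split.
  move=> xr i; apply: le_lt_trans xr.
  by rewrite [leRHS]mx_normrE; apply/bigmax_geP; right => /=; exists (ord0, i).
move=> h; rewrite [ltLHS]mx_normrE; apply/bigmax_ltP; split => // -[j i] _ /=.
by rewrite (ord1 j); exact: h.
Qed.

Lemma rat_approx (x : Rn) (e : R) : (0 < e)%R ->
  exists a : 'rV[rat]_n, (`|x - map_mx ratr a| < e)%R.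
Proof.
move=> e0.
have /choice[f hf] (i : 'I_n) : exists q : rat, (`|x 0 i - ratr q| < e)%R.
  have [q] := @rat_in_itvoo R (x 0 i - e)%R (x 0 i + e)%R ltac:(lra).
  by rewrite in_itv/= => /andP[h1 h2]; exists q; rewrite ltr_distl; apply/andP; split; lra.
exists (\row_i f i)%R; apply/coord_norm_lt => // i.
by rewrite !mxE; exact: hf.
Qed.

Lemma open_measurable_leb (U : set Rn) : open U -> (@measurable _ Leb) U.
Proof.
move=> oU.
pose Q (a : 'rV[rat]_n) (k : nat) : set Rn :=
  [set x | forall i, (`|x 0 i - (map_mx ratr a : Rn) 0 i| < k.+1%:R^-1)%R].
have -> : U = \bigcup_(a in [set: 'rV[rat]_n]) \bigcup_(k in [set k | Q a k `<=` U]) Q a k.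
  apply/seteqP; split => [x Ux|x [a _ [k /= QU Qx]]]; last exact: QU.
  have /nbhs_ballP[r /= r0 rU] : nbhs x U by exact: open_nbhs_nbhs.
  (* A rational cube that contains [x] and has half-side below [r / 2] lies in the ball of radius
     [r]. *)
  have [k hk] : exists k, (k.+1%:R^-1 < r / 2)%R.
    have /ltr_add_invr[k] : (0 < r / 2)%R by rewrite divr_gt0.
    by rewrite add0r; exists k.
  have k0 : (0 < k.+1%:R^-1 :> R)%R by rewrite invr_gt0.
  have [a /(coord_norm_lt _ k0) ha] := rat_approx x k0.
  have inv (y : Rn) : Q a k y <-> (`|y - map_mx ratr a| < k.+1%:R^-1)%R.
    rewrite coord_norm_lt// /Q /=; split => h i; first by move: (h i); rewrite !mxE.
    by move: (h i); rewrite !mxE.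
  exists a => //; exists k => /=; last by apply/inv/coord_norm_lt.
  move=> y /inv hy; apply: rU; rewrite -ball_normE /ball_/=.
  apply: le_lt_trans (ler_distD (map_mx ratr a) _ _) _.
  have hx : (`|x - map_mx ratr a| < k.+1%:R^-1)%R by apply/coord_norm_lt.
  rewrite [X in (_ + X)%R]distrC (splitr r).
  by apply: ltrD; [exact: lt_trans hx hk|exact: lt_trans hy hk].
apply: countable_bigcupT_measurable => // a.
apply: bigcup_measurable => k _; exact: cube_measurable.
Qed.

Lemma closed_measurable_leb (A : set Rn) : closed A -> (@measurable _ Leb) A.
Proof.
move=> cA; rewrite -(setCK A); apply: measurableC.
by apply: open_measurable_leb; exact: closed_openC.
Qed.

Lemma borel_measurable_leb d (T : measurableType d) (f : Rn -> T) :
  measurable_fun [set: Bor] (f : Bor -> T) -> measurable_fun [set: Leb] (f : Leb -> T).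
Proof.
move=> mf _ Y mY; rewrite setTI.
have : (@measurable _ Bor) (f @^-1` Y) by rewrite -[_ @^-1` _]setTI; exact: mf.
apply; split.
- split=> //; first by move=> A; rewrite setTD; exact: measurableC.
  by move=> F; exact: bigcupT_measurable.
- by move=> U; exact: open_measurable_leb.
Qed.

Lemma continuous_measurable_leb (g : Rn -> R) : continuous g ->
  measurable_fun [set: Leb] (g : Leb -> R).
Proof.
move=> cg; apply: (measurability _ (RGenOpens.measurableE R)).
move=> _ [_ [a [b ->]] <-]; rewrite setTI; apply: open_measurable_leb.
by move/continuousP: cg; apply; exact: interval_open.
Qed.

Lemma closed_ball0_measurable (M : R) : (@measurable _ Leb) [set x : Rn | (`|x| <= M)%R].
Proof.
apply: closed_measurable_leb.
have : closed ((fun x : Rn => `|x|%R) @^-1` [set r : R | (r <= M)%R]).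
  by apply: closed_comp => [x _|]; [exact: norm_continuous|exact: closed_le].
exact.
Qed.

(** Required by Tonelli's theorem in the comparison of Lebesgue measure with capacity. *)
Lemma lebn_sigma_finite : sigma_finite [set: Leb] lambda.
Proof.
exists (fun k => [set x : Rn | (`|x| <= k%:R)%R]).
  apply/seteqP; split => // x _; exists (Num.truncn `|x|%R).+1 => //=.
  exact/ltW/truncnS_gt.
by move=> k; split; [exact: closed_ball0_measurable|exact: lebn_bounded].
Qed.

HB.instance Definition _ := @Measure_isSigmaFinite.Build _ Leb R lambda lebn_sigma_finite.

End lebesgue_rn_topology.

(** * Reflection invariance, null sets, outer regularity *)

Section lebesgue_rn_invariance.
Context {R : realType} {n : nat}.
Local Notation Rn := 'rV[R]_n.
Local Notation Leb := (leb_space R n).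
Local Notation Bor := (borel_space R n).
Local Notation lambda := (@lebn R n).

(** Cutting [X] by the preimage of [Y] amounts to cutting the reflected [X] by [Y], and reflections
    preserve the outer measure. *)
Lemma measurable_reflect (x : Rn) :
  measurable_fun [set: Leb] ((fun y : Rn => (x - y)%R) : Leb -> Leb).
Proof.
move=> _ Y mY; rewrite setTI.
suff h : (@lebesgue_outer R n).-caratheodory ((fun y : Rn => (x - y)%R) @^-1` Y) by exact: h.
move=> X; pose T (A : set Rn) : set Rn := (fun y : Rn => (x - y)%R) @^-1` A.
have TT A : T (T A) = A by apply/seteqP; split => y; rewrite /T /= subKr.
have r A : lebesgue_outer (T A) = lebesgue_outer A by exact: lebesgue_outer_reflect.
have h : lebesgue_outer (T X) = lebesgue_outer (T X `&` Y) + lebesgue_outer (T X `&` ~` Y).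
  exact: mY.
by rewrite -r h -(r (T X `&` Y)) -(r (T X `&` ~` Y)) -{3}(TT X) -{4}(TT X).
Qed.

Lemma integral_reflect (x : Rn) (f : Rn -> \bar R) :
  lebesgue_measurable f -> (forall y, 0 <= f y) ->
  \int[lambda]_y f (x - y)%R = \int[lambda]_y f y.
Proof.
move=> mf f0; pose T : Leb -> Leb := fun y : Rn => (x - y)%R.
have mT : measurable_fun [set: Leb] T by exact: measurable_reflect.
transitivity (\int[pushforward lambda T]_y f y); last first.
  by apply: eq_measure_integral => A _ _; exact: lebesgue_outer_reflect.
by rewrite (ge0_integral_pushforward mT).
Qed.

Lemma lebesgue_measurable_reflect (x : Rn) (f : Rn -> \bar R) :
  lebesgue_measurable f -> lebesgue_measurable (fun y => f (x - y)%R).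
Proof. by move=> mf; apply: (measurableT_comp mf); exact: measurable_reflect. Qed.

Lemma integral_reflect_signed (x : Rn) (f : Rn -> \bar R) :
  lebesgue_measurable f ->
  \int[lambda]_y f (x - y)%R = \int[lambda]_y f y.
Proof.
move=> mf; rewrite integralE [RHS]integralE; congr (_ - _).
  rewrite -(integral_reflect x (f := f^\+)); [|exact: measurable_funepos|exact: funepos_ge0].
  by apply: eq_integral => y _; rewrite !funeposE.
rewrite -(integral_reflect x (f := f^\-)); [|exact: measurable_funeneg|exact: funeneg_ge0].
by apply: eq_integral => y _; rewrite !funenegE.
Qed.

(** A translation is composed of two reflections. *)
Lemma lebn_translate (x : Rn) (A : set Rn) :
  lambda [set y | A (y - x)%R] = lambda A.
Proof.
rewrite /lebn -[RHS](lebesgue_outer_reflect 0%R) -[RHS](lebesgue_outer_reflect x).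
by congr lebesgue_outer; apply/seteqP; split => y /=; rewrite sub0r opprB.
Qed.

(** Completeness: a set of outer measure 0 passes Caratheodory's test, so it is its own measurable
    null cover. *)
Lemma lebn_null (N : set Rn) : lambda N = 0 -> lambda.-negligible N.
Proof.
move=> N0; exists N; split => //.
apply: le_caratheodory_measurable => X.
have XN : lebesgue_outer (X `&` N) <= 0.
  by rewrite -N0; apply: le_outer_measure; exact: subIsetr.
have XNC : lebesgue_outer (X `&` ~` N) <= lebesgue_outer X.
  by apply: le_outer_measure; exact: subIsetl.
by apply: le_trans (leeD XN XNC) _; rewrite add0e.
Qed.

Lemma negligible_lebn (N : set Rn) : lambda.-negligible N -> lambda N = 0.
Proof.
move=> [M [mM M0 NM]]; apply/eqP; rewrite eq_le outer_measure_ge0 andbT -M0.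
exact: le_outer_measure.
Qed.

Lemma le_lebn (A B : set Rn) : A `<=` B -> lambda A <= lambda B.
Proof. exact: le_outer_measure. Qed.

Lemma lebnU_le (A B : set Rn) : lambda (A `|` B) <= lambda A + lambda B.
Proof. exact: outer_measureU2. Qed.

Lemma open_rect (a b : Rn) :
  open [set x : Rn | forall i, (a 0 i < x 0 i < b 0 i)%R].
Proof.
rewrite openE => x /= h.
suff : forall i, nbhs x [set y : Rn | (a 0 i < y 0 i < b 0 i)%R] by move=> hi; apply: (@filter_forall Rn _ (fun i y => (a 0 i < y 0 i < b 0 i)%R) (nbhs x)) => // i; exact: hi.
move=> i.
have oi : open [set r : R | (a 0 i < r < b 0 i)%R].
  have -> : [set r : R | (a 0 i < r < b 0 i)%R] =
      [set r : R | (a 0 i < r)%R] `&` [set r : R | (r < b 0 i)%R].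
    by apply/seteqP; split => r /= => [/andP[]//|[-> ->]].
  by apply: openI; [exact: open_gt|exact: open_lt].
have : nbhs (x 0 i)%R [set r : R | (a 0 i < r < b 0 i)%R].
  by apply: open_nbhs_nbhs; split => //; exact: h.
by move=> hx; exact: (@coord_continuous R 1 n 0%R i x _ hx).
Qed.

(** A finite [box_volume] is almost attained at some corners. One half of [eta] pays for that, the
    other for moving the upper faces outwards by [t]. *)
Lemma box_volume_open (F : set Rn) (eta : R) : (0 < eta)%R ->
  exists U : set Rn, [/\ open U, F `<=` U & lambda U <= box_volume F + eta%:E].
Proof.
move=> eta0; have bF0 := box_volume_ge0 F.
have [bFy|bFy] := eqVneq (box_volume F) +oo.
  by exists setT; split => //; [exact: openT|rewrite bFy addye ?leey].
have fF : box_volume F \is a fin_num by rewrite ge0_fin_numE// ltey.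
have e2 : (0 < eta / 2)%R by rewrite divr_gt0.
have [->|/set0P[x0 Fx0]] := eqVneq F set0.
  exists set0; split => //.
  rewrite /lebn outer_measure0.
  by apply: adde_ge0; [exact: box_volume_ge0|rewrite lee_fin ltW].
have [a [b [Fab hv]]] : exists a b : Rn, F = box a b /\
    (\prod_(i < n) (b 0 i - a 0 i))%:E <= box_volume F + (eta / 2)%:E.
  move: fF {bF0 bFy}; rewrite /box_volume; case: asboolP => [F0|_ fF].
    by move: Fx0; rewrite F0.
  have [_ [a [b [Fab ->]]] h] := lb_ereal_inf_adherent e2 fF.
  by exists a, b; split => //; exact: ltW.
have [t t0 ht] := prodD_small (fun i => (b 0 i - a 0 i)%R) e2.
pose b' : Rn := (\row_i (b 0 i + t))%R.
have ab i : (a 0 i <= b 0 i)%R.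
  by move: Fx0; rewrite Fab => /(_ i)/andP[/ltW]; exact: le_trans.
exists [set x | forall i, (a 0 i < x 0 i < b' 0 i)%R]; split.
- exact: open_rect.
- rewrite Fab => x xab i; rewrite mxE.
  by have /andP[-> /=] := xab i; move=> /le_lt_trans; apply; rewrite ltrDl.
- apply: (@le_trans _ _ (lambda (box a b'))).
    by apply: le_lebn => x h i; have /andP[-> /ltW] := h i.
  apply: le_trans (lebesgue_outer_box _) _.
    by move=> i; rewrite mxE; apply: le_trans (ab i) _; rewrite lerDl ltW.
  rewrite [eta]splitr EFinD addeA; apply: le_trans (leeD2r _ hv).
  rewrite -EFinD lee_fin; apply: le_trans ht; apply: ler_prod => i _.
  by rewrite mxE addrAC lexx andbT addr_ge0 ?(ltW t0)// subr_ge0.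
Qed.

Lemma lebn_outer_regular (A : set Rn) (eta : R) : (0 < eta)%R -> lambda A < +oo ->
  exists U : set Rn, [/\ open U, A `<=` U & lambda U <= lambda A + eta%:E].
Proof.
move=> eta0 Afin.
have fA : lambda A \is a fin_num by rewrite ge0_fin_numE.
have e2 : (0 < eta / 2)%R by rewrite divr_gt0.
have [_ [F [mF AF] <-] hF] := lb_ereal_inf_adherent e2 fA.
(* The enlargements form a geometric series of sum [eta / 2]; the other half was spent on the cover
   [F]. *)
have /choice[U hU] (k : nat) : exists U : set Rn, [/\ open U, F k `<=` U &
    lambda U <= box_volume (F k) + (eta / 2 / (2 ^ k.+1)%:R)%:E].
  by apply: box_volume_open; rewrite divr_gt0// ltr0n expn_gt0.
exists (\bigcup_k U k); split.
- by apply: bigcup_open => k _; have [] := hU k.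
- by move=> x /AF[k _ Fk]; exists k => //; have [_ + _] := hU k; exact.
- apply: le_trans (outer_measure_sigma_subadditive _ _) _.
  apply: (@le_trans _ _ (\sum_(0 <= k <oo) (box_volume (F k) + (eta / 2 / (2 ^ k.+1)%:R)%:E))).
    by apply: lee_nneseries => [k _ _|k _]; [exact: outer_measure_ge0|have [] := hU k].
  apply: le_trans (epsilon_trick _ _ (ltW e2)) _ => [k|]; first exact: box_volume_ge0.
  apply: le_trans (leeD2r _ (ltW hF)) _.
  by rewrite -addeA -EFinD -splitr.
Qed.

End lebesgue_rn_invariance.

(** * The Bessel kernel, capacity and Lebesgue measure *)

Section kernel.
Context {R : realType} {n : nat}.
Local Notation Rn := 'rV[R]_n.
Local Notation Leb := (leb_space R n).
Local Notation Bor := (borel_space R n).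
Local Notation lambda := (@lebn R n).

(** Gives, for Borel [G], the joint measurability of [G (x - y)] that Tonelli's theorem asks for:
    preimages of open sets are countable unions of products of rational cubes. *)
Lemma measurable_sub_borel :
  measurable_fun [set: (Leb * Leb)%type]
    ((fun z : Rn * Rn => (z.1 - z.2)%R) : (Leb * Leb)%type -> Bor).
Proof.
apply: (measurability _ (erefl (@measurable _ Bor))).
move=> _ [U oU <-]; rewrite setTI.
pose Q (a : 'rV[rat]_n) (k : nat) : set Rn :=
  [set x | forall i, (`|x 0 i - (map_mx ratr a : Rn) 0 i| < k.+1%:R^-1)%R].
have inv (a : 'rV[rat]_n) k (y : Rn) :
    Q a k y <-> (`|y - map_mx ratr a| < k.+1%:R^-1)%R.
  rewrite coord_norm_lt ?invr_gt0//.
  by rewrite /Q /=; split => h i; move: (h i); rewrite !mxE.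
have -> : (fun z : Rn * Rn => (z.1 - z.2)%R) @^-1` U =
  \bigcup_(a in [set: 'rV[rat]_n]) \bigcup_(b in [set: 'rV[rat]_n])
   \bigcup_(k in [set k | Q a k `*` Q b k `<=` (fun z : Rn * Rn => (z.1 - z.2)%R) @^-1` U])
     (Q a k `*` Q b k).
  apply/seteqP; split => [[x y] /= Uxy|z [a _ [b _ [k /= QU Qz]]]]; last exact: QU.
  have /nbhs_ballP[r /= r0 rU] : nbhs (x - y)%R U by exact: open_nbhs_nbhs.
  (* The error x - y - (x' - y') splits into four differences, one for each of the four points. *)
  have [k hk] : exists k, (k.+1%:R^-1 < r / 4)%R.
    have /ltr_add_invr[k] : (0 < r / 4)%R by rewrite divr_gt0.
    by rewrite add0r; exists k.
  have k0 : (0 < k.+1%:R^-1 :> R)%R by rewrite invr_gt0.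
  have [a ha] := rat_approx x k0.
  have [b hb] := rat_approx y k0.
  exists a => //; exists b => //; exists k => /=; last by split; apply/inv.
  move=> [x' y'] /= [/inv ha' /inv hb']; apply: rU; rewrite -ball_normE /ball_/=.
  have -> : (x - y - (x' - y') =
      ((x - map_mx ratr a) - (x' - map_mx ratr a)) -
      ((y - map_mx ratr b) - (y' - map_mx ratr b)))%R.
    by rewrite !opprB !addrA; apply/rowP => i; rewrite !mxE; ring.
  apply: (le_lt_trans (ler_normB _ _)).
  rewrite (_ : r = (r / 4 + r / 4) + (r / 4 + r / 4))%R; last by lra.
  apply: ltrD; apply: (le_lt_trans (ler_normB _ _)); apply: ltrD.
  - exact: lt_trans ha hk.
  - exact: lt_trans ha' hk.
  - exact: lt_trans hb hk.
  - exact: lt_trans hb' hk.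
apply: countable_bigcupT_measurable => // a.
apply: countable_bigcupT_measurable => // b.
by apply: bigcup_measurable => k _; apply: measurableX; exact: cube_measurable.
Qed.

Lemma integral_tail (g : Rn -> \bar R) (e : R) : lebesgue_measurable g ->
  (forall x, 0 <= g x) -> \int[lambda]_x g x < +oo -> (0 < e)%R ->
  exists k : nat, \int[lambda]_(x in ~` [set x : Rn | (`|x| <= k%:R)%R]) g x <= e%:E.
Proof.
move=> mg g0 gfin e0; pose F k := [set x : Rn | (`|x| <= k%:R)%R].
have mF k : (@measurable _ Leb) (F k) by exact: closed_ball0_measurable.
have UF : \bigcup_k F k = setT.
  apply/seteqP; split => // x _; exists (Num.truncn `|x|%R).+1 => //=.
  exact/ltW/truncnS_gt.
have ndF : nondecreasing_seq (F : (set Leb)^nat).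
  by move=> a b ab; apply/subsetPset => x /= /le_trans; apply; rewrite ler_nat.
have := @ge0_nondecreasing_set_cvg_integral _ Leb R F g lambda ndF mF
  (fun i => measurable_funTS mg) (fun _ x _ => g0 x).
rewrite UF => cvgF.
have I0 : 0 <= \int[lambda]_x g x by exact: integral_ge0.
have fI : \int[lambda]_x g x \is a fin_num by rewrite ge0_fin_numE.
have : \int[lambda]_x g x - e%:E < \int[lambda]_x g x.
  by rewrite lteBlDr// -[X in X < _]adde0 lteD2lE// lte_fin.
move=> hI; have /cvgF[k _ /(_ k (leqnn k)) /= hk] :
    nbhs (\int[lambda]_x g x) [set y | \int[lambda]_x g x - e%:E < y].
  by apply: open_nbhs_nbhs; split => //; exact: open_ereal_gt_ereal.
exists k; have := @ge0_integral_setU _ Leb R lambda (F k) (~` F k) (mF k)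
  (measurableC (mF k)) g; rewrite setUCr => /(_ mg (fun x _ => g0 x)) hU.
rewrite -/(F k); have fk : \int[lambda]_(x in F k) g x \is a fin_num.
  rewrite ge0_fin_numE; last exact: integral_ge0.
  by apply: le_lt_trans gfin; apply: ge0_subset_integral.
move: hk; rewrite hU; last by apply/disj_setPS; rewrite setICr.
have [r hr] : exists r, \int[lambda]_(x in F k) g x = r%:E.
  by exists (fine (\int[lambda]_(x in F k) g x)); rewrite fineK.
rewrite hr; case: (\int[lambda]_(x in ~` F k) g x) => [u| |]//.
  by rewrite -EFinD lte_fin lee_fin => h; lra.
by move=> _; rewrite leNye.
Qed.

Section bessel_kernel.
Variables (alpha : R) (G : Rn -> R).
Hypothesis hG : is_bessel_kernel alpha G.

Let mGb : measurable_fun [set: Bor] (G : Bor -> R).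
Proof. by have [] := hG. Qed.

Let mG : lebesgue_measurable (EFin \o G).
Proof. by apply/measurable_EFinP; exact: borel_measurable_leb. Qed.

Let iG : lambda.-integrable [set: Leb] (fun x => (G x)%:E).
Proof. by have [] := hG. Qed.

(** This is the value of the Fourier transform at frequency 0. *)
Lemma integral_kernel : \int[lambda]_x (G x)%:E = 1.
Proof.
have [_ _ /(_ 0%R)[+ _]] := hG.
have e0 (x : Rn) : edot x 0%R = 0%R :> R.
  by rewrite /edot big1// => i _; rewrite mxE mulr0.
rewrite /enorm e0 sqrtr0 expr0n/= addr0 powR1 => <-.
by apply: eq_integral => x _; rewrite e0 cos0 mulr1.
Qed.

(** Box volumes have so far bounded Lebesgue measure only from above; positivity comes from the
    kernel. If one ball were null, countably many translates of it would cover the space, and the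
    integral of [G] would be 0 instead of 1. *)
Lemma lebn_ball_gt0 (x : Rn) (r : R) : (0 < r)%R ->
  0 < lambda [set y | (`|y - x| < r)%R].
Proof.
move=> r0; rewrite lt_neqAle outer_measure_ge0 andbT; apply/negP => /eqP h0.
have b0 (a : Rn) : lambda [set y | (`|y - a| < r)%R] = 0.
  rewrite [RHS]h0 -[RHS](lebn_translate (a - x)%R); congr lebn.
  have e y : (y - (a - x) - x = y - a)%R by rewrite opprB addrA -addrAC addrK.
  by apply/seteqP; split => y /=; rewrite e.
have T0 : lambda [set: Rn] = 0.
  pose f k : set Rn := if unpickle k is Some a
    then [set y | (`|y - (map_mx ratr (a : 'rV[rat]_n) : Rn)| < r)%R] else set0.
  apply/eqP; rewrite eq_le outer_measure_ge0 andbT.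
  have sT : [set: Rn] `<=` \bigcup_k f k.
    move=> y _; have [a ha] := rat_approx y r0.
    by exists (pickle a) => //; rewrite /f pickleK.
  apply: le_trans (le_lebn sT) _.
  apply: le_trans (outer_measure_sigma_subadditive _ _) _.
  rewrite eseries0// => k _ _; rewrite /f.
  by case: unpickle => [a|]; [exact: b0|exact: outer_measure0].
have := integral_kernel.
rewrite (@null_set_integral _ Leb R lambda setT (EFin \o G)) //.
by move=> /eqP; rewrite eqe eq_sym oner_eq0.
Qed.

(** As [is_bessel_kernel] does not state the sign of [G], estimates are made with |G| and its mass
    [M]. Only [0 <= M] is recorded, whence the [M + 1] below. *)
Let M := fine (\int[lambda]_x `|(G x)%:E|).

Let M_ge0 : (0 <= M)%R.
Proof. by apply: fine_ge0; exact: integral_ge0. Qed.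

Let ME : \int[lambda]_x `|(G x)%:E| = M%:E.
Proof.
rewrite fineK// ge0_fin_numE; last exact: integral_ge0.
by have /integrableP[] := iG.
Qed.

Let mabsG : lebesgue_measurable (fun x => `|(G x)%:E|).
Proof. exact: measurableT_comp mG. Qed.

Let iaG : lambda.-integrable [set: Leb] (fun x => `|(G x)%:E|).
Proof. exact: integrable_abse iG. Qed.

Lemma integral_kernel_l (x : Rn) : \int[lambda]_y `|(G (x - y))%:E| = M%:E.
Proof. by rewrite -ME -(integral_reflect x (f := fun y => `|(G y)%:E|)). Qed.

Let mabsGr (y : Rn) : lebesgue_measurable (fun x => `|(G (x - y))%:E|).
Proof.
have -> : (fun x : Rn => `|(G (x - y))%:E|) =
          fun x => (fun z => `|(G (0 - z))%:E|) (y - x)%R.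
  by apply/funext => x; rewrite sub0r opprB.
exact: (lebesgue_measurable_reflect y (lebesgue_measurable_reflect 0%R mabsG)).
Qed.

Lemma integral_kernel_r (y : Rn) : \int[lambda]_x `|(G (x - y))%:E| = M%:E.
Proof.
have -> : (fun x : Rn => `|(G (x - y))%:E|) =
          fun x => (fun z => `|(G (0 - z))%:E|) (y - x)%R.
  by apply/funext => x; rewrite sub0r opprB.
rewrite (integral_reflect y (f := fun z => `|(G (0 - z)%R)%:E|))//.
  exact: integral_kernel_l.
exact: lebesgue_measurable_reflect mabsG.
Qed.

(** For t > e the factor t^(1-s) is at most e^(1-s), as 1 - s < 0. This takes the place of Hölder's
    inequality: with [e] small, the constant term can be absorbed. *)
Lemma poweR_split (s e : R) (t : \bar R) : (1 < s)%R -> (0 < e)%R -> 0 <= t ->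
  t <= e%:E + (e `^ (1 - s))%:E * t `^ s.
Proof.
move=> s1 e0; case: t => [t| |]//.
- rewrite lee_fin => t0; rewrite poweR_EFin -EFinM -EFinD lee_fin.
  have [te|et] := leP t e.
    by apply: (le_trans te); rewrite lerDl mulr_ge0// powR_ge0.
  rewrite -[leLHS]add0r; apply: lerD; first exact: ltW.
  have tt : (t = t `^ (1 - s) * t `^ s)%R.
    rewrite -powRD ?subrK ?powRr1//.
    by rewrite oner_eq0.
  rewrite {1}tt; apply: ler_wpM2r; first exact: powR_ge0.
  have -> : (1 - s = - (s - 1))%R by ring.
  rewrite !powRN lef_pV2 ?posrE ?powR_gt0// ?(lt_trans e0)//.
  by apply: ge0_ler_powR; rewrite ?nnegrE ?subr_ge0 ?(ltW s1) ?(ltW e0)// ltW.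
- move=> _; rewrite poweRyr; last by rewrite gt_eqF// (lt_trans ltr01).
  by rewrite gt0_muley ?lte_fin ?powR_gt0// addey.
Qed.

Variable s : R.
Hypothesis s1 : (1 < s)%R.

(** Since [e * M <= 1/2], half of the lower bound 1 survives the term [e * M]; the factor [k] below
    restores it to 1. *)
Let e := (2 * (M + 1))^-1%R.
Let e0 : (0 < e)%R.
Proof. by rewrite invr_gt0 mulr_gt0// ltr_wpDl. Qed.

Let eM : (e * M <= 2^-1)%R.
Proof.
rewrite /e invfM -mulrA ler_piMr ?invr_ge0//.
by rewrite mulrC ler_pdivrMr ?ltr_wpDl// mul1r lerDl.
Qed.

Let k := (2 * e `^ (1 - s))%R.
Let k0 : (0 < k)%R. Proof. by rewrite mulr_gt0// powR_gt0. Qed.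

(* [t <= e + e ^ (1 - s) * t ^ s] turns [1 <= G * f] into a lower bound on the
   L^1 function [|G| * f ^ s], which Tonelli and Chebyshev exploit. *)
Lemma lebn_le_Lnorm (E : set Rn) (f : Rn -> \bar R) :
  lebesgue_measurable f -> (forall x, 0 <= f x) ->
  (forall x, E x -> 1 <= convol G f x) ->
  lambda E <= (k * M)%:E * 'N[lambda]_s%:E[f] `^ s.
Proof.
move=> mf f0 Ef.
rewrite (@poweR_Lnorm _ Leb); last by rewrite gt_eqF// (lt_trans ltr01).
pose h (z : Rn * Rn) : \bar R := `|(G (z.1 - z.2))%:E| * f z.2 `^ s.
have h0 z : 0 <= h z by rewrite mule_ge0// poweR_ge0.
have mfs : lebesgue_measurable (fun y => f y `^ s).
  exact: (measurableT_comp (measurable_poweR s)) mf.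
have mh : measurable_fun [set: (Leb * Leb)%type] (h : (Leb * Leb)%type -> \bar R).
  apply: emeasurable_funM.
    apply: measurableT_comp => //; apply/measurable_EFinP.
    exact: measurableT_comp mGb measurable_sub_borel.
  exact: measurableT_comp mfs measurable_snd.
pose g x := \int[lambda]_y h (x, y).
have g0 x : 0 <= g x by exact: integral_ge0.
have mg : lebesgue_measurable g.
  exact: (@measurable_fun_fubini_tonelli_F _ _ Leb Leb R lambda h mh h0).
have gI : \int[lambda]_x g x = M%:E * \int[lambda]_y f y `^ s.
  rewrite (@fubini_tonelli _ _ Leb Leb R lambda lambda h mh h0).
  rewrite -ge0_integralZl ?lee_fin//; last by move=> *; exact: poweR_ge0.
  apply: eq_integral => y _; rewrite /h /=.
  have := @ge0_integralZr _ Leb R lambda setT measurableT _ (mabsGr y) (f y `^ s)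
    (fun _ _ => abse_ge0 _) (poweR_ge0 _ _).
  by rewrite integral_kernel_r.
have Eg x : E x -> 1 <= k%:E * g x.
  move=> Ex; have mGx : lebesgue_measurable (fun y => (G (x - y))%:E).
    exact: lebesgue_measurable_reflect mG.
  have mGx' : lebesgue_measurable (fun y => `|(G (x - y))%:E|).
    exact: measurableT_comp mGx.
  have h1 : 1 <= \int[lambda]_y (`|(G (x - y))%:E| * f y).
    apply: (le_trans (Ef _ Ex)); apply: (le_trans (lee_abs _)).
    apply: (le_trans (@le_abse_integral _ Leb R lambda _ _ measurableT _)).
      exact: emeasurable_funM.
    by under eq_integral do rewrite abseM (gee0_abs (f0 _)).
  have h2 : 1 <= e%:E * M%:E + (e `^ (1 - s))%:E * g x.
    apply: (le_trans h1).
    have mhx : lebesgue_measurable (fun y => h (x, y)).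
      by apply: emeasurable_funM.
    have E1 : \int[lambda]_y (e%:E * `|(G (x - y))%:E|) = e%:E * M%:E.
      rewrite -(integral_kernel_l x).
      by apply: (@ge0_integralZl_EFin _ Leb R lambda) => //; exact: ltW.
    have E2 : \int[lambda]_y ((e `^ (1 - s))%:E * h (x, y)) = (e `^ (1 - s))%:E * g x.
      by apply: (@ge0_integralZl_EFin _ Leb R lambda) => //; exact: powR_ge0.
    have := @ge0_integralD _ Leb R lambda setT measurableT
      (fun y => e%:E * `|(G (x - y))%:E|) (fun y => (e `^ (1 - s))%:E * h (x, y)).
    rewrite E1 E2 => <-; last 4 first.
    - by move=> y _; rewrite mule_ge0// lee_fin ltW.
    - exact: measurable_funeM.
    - by move=> y _; apply: mule_ge0; [rewrite lee_fin; exact: powR_ge0|exact: h0].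
    - exact: measurable_funeM.
    apply: ge0_le_integral; first exact: measurableT.
    - by move=> y _; apply: mule_ge0; [exact: abse_ge0|exact: f0].
    - exact: emeasurable_funM.
    - by apply: emeasurable_funD; exact: measurable_funeM.
    - move=> y _; have := poweR_split s1 e0 (f0 y).
      move=> /(lee_wpmul2l (abse_ge0 (G (x - y))%:E)) /le_trans; apply.
      rewrite muleDr ?ge0_adde_def ?inE ?lee_fin ?(ltW e0)//; last first.
        by rewrite mule_ge0// ?lee_fin ?powR_ge0// poweR_ge0.
      by rewrite muleC /h /= [X in _ + X]muleCA.
  rewrite /k EFinM -muleA; move: h2; have c0 := powR_gt0 (1 - s) e0.
  have := g0 x; case: (g x) => [r| |]// r0.
  - rewrite -!EFinM -EFinD !lee_fin => h2.
    have := eM; lra.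
  - by move=> _; rewrite !gt0_muley ?lte_fin ?leey.
have ki0 : (0 < k^-1)%R by rewrite invr_gt0.
have sub : E `<=` [set: Rn] `&` [set x | (k^-1)%:E <= `|g x|].
  move=> x /Eg h1; split => //=.
  by rewrite (gee0_abs (g0 x)) -(@lee_pmul2l _ k%:E) ?lte_fin// -EFinM mulfV ?gt_eqF.
have kk : (k%:E * (k^-1)%:E = 1 :> \bar R) by rewrite -EFinM mulfV ?gt_eqF.
have h3 : (k^-1)%:E * lambda E <= M%:E * \int[lambda]_y f y `^ s.
  rewrite -gI; have := @le_integral_abse _ Leb R lambda setT measurableT g _ mg ki0.
  under eq_integral do rewrite (gee0_abs (g0 _)).
  by apply: le_trans; apply: lee_wpmul2l; [rewrite lee_fin ltW|exact: le_lebn].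
have : k%:E * ((k^-1)%:E * lambda E) <= k%:E * (M%:E * \int[lambda]_y f y `^ s).
  by apply: lee_wpmul2l h3; rewrite lee_fin ltW.
rewrite !muleA kk mul1e -EFinM => /le_trans; apply.
by under [in leRHS]eq_integral do rewrite (gee0_abs (f0 _)).
Qed.

Lemma lebn_le_capacity : exists2 K : R, (0 < K)%R &
  forall E : set Rn, lambda E <= K%:E * capacity G s E.
Proof.
have kM : (0 < k * (M + 1))%R by rewrite mulr_gt0// ltr_wpDl.
exists (k * (M + 1))%R => // E.
rewrite muleC -lee_pdivrMr//.
apply: le_ereal_inf_tmp => _ [f [mf f0 Ef] <-].
rewrite lee_pdivrMr// muleC.
apply: (le_trans (lebn_le_Lnorm mf f0 Ef)); apply: lee_wpmul2r.
  exact: poweR_ge0.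
by rewrite lee_fin ler_pM2l// lerDl.
Qed.

(** The competitor is 2 on a ball enlarged by [N], where |G| has mass at most 1/2 beyond radius [N].
    Its potential on the given ball is at least 2 minus twice that mass, hence at least 1. *)
Lemma capacity_bounded (r : R) : capacity G s [set x : Rn | (`|x| <= r)%R] < +oo.
Proof.
have Gfin : \int[lambda]_x `|(G x)%:E| < +oo by rewrite ME ltry.
have h0 : (0 < 2^-1 :> R)%R by rewrite invr_gt0.
have [N hN] := integral_tail mabsG (fun _ => abse_ge0 _) Gfin h0.
pose B : set Rn := [set y | (`|y| <= N%:R + `|r|)%R].
have mB : (@measurable _ Leb) B by exact: closed_ball0_measurable.
pose f (y : Rn) : \bar R := (2 * \1_B y)%:E.
have mf : lebesgue_measurable f.
  by apply/measurable_EFinP; apply: measurable_funM.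
have f0 y : 0 <= f y by rewrite lee_fin mulr_ge0.
apply: (@le_lt_trans _ _ ('N[lambda]_s%:E[f] `^ s)).
  apply: ereal_inf_lbound; exists f => //; split => // x /= xr.
  pose C : set Rn := ~` [set x : Rn | (`|x| <= N%:R)%R].
  have mC : (@measurable _ Leb) C by apply: measurableC; exact: closed_ball0_measurable.
  pose g1 (z : Rn) : \bar R := (G z * (2 * \1_B (x - z)))%:E.
  pose gC : Rn -> \bar R := (fun z => `|(G z)%:E|) \_ C.
  (* A minorant of [g1]: on [C] the value 2 G - 2 |G| is below both 0 and 2 G, the two possible
     values of [g1]; off [C] the indicator is 1 and [g1] is 2 G. *)
  pose g2 (z : Rn) : \bar R := 2%:E * (G z)%:E - 2%:E * gC z.
  have mBx : measurable_fun [set: Leb] ((fun z : Rn => \1_B (x - z)%R : R) : Leb -> R).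
    by apply: (measurableT_comp (measurable_indic mB)); exact: measurable_reflect.
  have mg1 : lebesgue_measurable g1.
    apply/measurable_EFinP; apply: measurable_funM; first exact/measurable_EFinP.
    exact: measurable_funM.
  have -> : convol G f x = \int[lambda]_z g1 z.
    rewrite -(integral_reflect_signed x mg1).
    by apply: eq_integral => y _; rewrite /g1 /f subKr -EFinM.
  have i2G : lambda.-integrable [set: Leb] (fun z => 2%:E * (G z)%:E).
    exact: integrableZl.
  have ig1 : lambda.-integrable [set: Leb] g1.
    apply: (le_integrable measurableT mg1 _ i2G) => z _.
    rewrite /g1 -EFinM !abse_EFin lee_fin indicE.
    by case: (_ \in _); rewrite ?mulr1 ?mulr0 ?normr0// mulrC.
  have igC : lambda.-integrable [set: Leb] gC.
    apply: (iffLR (integrable_mkcond _ mC)).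
    exact: (@integrableS _ Leb R lambda setT C _ measurableT mC (@subsetT _ _) iaG).
  have i2C : lambda.-integrable [set: Leb] (fun z => 2%:E * gC z).
    exact: integrableZl.
  have ig2 : lambda.-integrable [set: Leb] g2 by exact: integrableB.
  apply: (@le_trans _ _ (\int[lambda]_z g2 z)); last first.
    apply: le_integral => // z _; rewrite /g2 /gC /g1 /patch.
    have := ler_norm (G z); have := ler_norm (- G z); rewrite normrN => n1 n2.
    case: ifPn => zC.
      rewrite abse_EFin -!EFinM -EFinB lee_fin indicE.
      by case: (_ \in _) => /=; nra.
    rewrite mule0 sube0 -EFinM lee_fin indicE mem_set ?mulr1; first by rewrite mulrC.
    move: zC; rewrite notin_setE /C /B /= => /contrapT zN.
    apply: (le_trans (ler_normB _ _)); rewrite addrC lerD//.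
    exact: (le_trans xr (ler_norm _)).
  rewrite integralB// integralZl// integral_kernel mule1 integralZl//.
  rewrite /gC -integral_mkcond -/C in hN *.
  have tail0 : 0 <= \int[lambda]_(z in C) `|(G z)%:E| by exact: integral_ge0.
  move: tail0 hN; case: (\int[lambda]_(z in C) _) => [u| |]//.
  by rewrite -EFinM -EFinB !lee_fin => u0 hu; lra.
rewrite (@poweR_Lnorm _ Leb); last by rewrite gt_eqF// (lt_trans ltr01).
apply: (@le_lt_trans _ _ (\int[lambda]_(y in B) (2 `^ s)%:E)).
  rewrite [leRHS]integral_mkcond le_eqVlt; apply/orP; left; apply/eqP.
  apply: eq_integral => y _; rewrite /f /patch gee0_abs// indicE.
  by case: (y \in B); rewrite ?mulr1 ?mulr0 ?poweR_EFin// powR0// gt_eqF// (lt_trans ltr01).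
by rewrite integral_cst// lte_mul_pinfty ?lee_fin ?powR_ge0// lebn_bounded.
Qed.


End bessel_kernel.
End kernel.

(** * Integrals over the half-line *)

Section half_line.
Context {R : realType}.
Local Notation mu := (@lebesgue_measure R).

(** Behind the homogeneity of both [lorentz_int] and [cap_norm]. The image of Lebesgue measure under
    t -> c t, multiplied by [c], agrees with Lebesgue measure on intervals, hence on all measurable
    sets. *)
Lemma integral_half_line_scale (f : R -> \bar R) (c : R) : (0 < c)%R ->
  measurable_fun [set: R] f -> (forall t, 0 <= f t) ->
  \int[mu]_(t in `]0%R, +oo[) f t =
  c%:E * \int[mu]_(t in `]0%R, +oo[) f (c * t)%R.
Proof.
move=> c0 mf f0.
pose T : measurableTypeR R -> measurableTypeR R := fun t => (c * t)%R.
have mT : measurable_fun [set: measurableTypeR R] T by exact: measurable_funM.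
pose cn : {nonneg R} := NngNum (ltW c0).
pose nu := mscale cn (measure_function_pushforward__canonical__measure_function_Measure mu mT).
have nuE A : measurable A -> mu A = nu A.
  apply: lebesgue_measure_unique => _ [[a b] _ <-] /=.
  rewrite /nu /mscale /= /pushforward.
  have -> : T @^-1` `]a, b]%classic = `](a / c)%R, (b / c)%R]%classic.
    by apply/seteqP; split => t /=; rewrite !in_itv/= /T ltr_pdivrMr// ler_pdivlMr//
      (mulrC c).
  rewrite !lebesgue_measure_itv/= !lte_fin ltr_pM2r ?invr_gt0//.
  by case: ifP => _; rewrite ?mule0// -!EFinB -EFinM -mulrBl mulrCA mulfV ?mulr1// gt_eqF.
have mI : measurable (`]0%R, +oo[%classic : set R) by [].
rewrite (eq_measure_integral nu) => [|A mA _]; last exact: nuE.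
rewrite /nu ge0_integral_mscale//; last exact: measurable_funTS.
congr (_ * _).
rewrite (ge0_integral_pushforward mT)//; last exact: measurable_funTS.
have -> // : T @^-1` `]0%R, +oo[%classic = `]0%R, +oo[%classic.
by apply/seteqP; split => t /=; rewrite !in_itv/= !andbT /T pmulr_rgt0.
Qed.

(** Superlevel sets are intervals. This applies to measures and capacities of level sets, whatever
    the function whose levels are taken. *)
Lemma nonincreasing_emeasurable (D : set R) (f : R -> \bar R) : measurable D ->
  (forall s t, (s <= t)%R -> f t <= f s) -> measurable_fun D f.
Proof.
move=> mD f_ni; apply: (measurability _ (ErealGenOInfty.measurableE R)).
move=> _ [_ [r ->] <-]; apply: measurableI => //.
apply: is_interval_measurable => s t /=; rewrite !in_itv/= !andbT.
move=> fs ft u /andP[su ut]; rewrite in_itv/= andbT.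
by apply: (lt_le_trans ft); exact: f_ni.
Qed.

Lemma cvge0P (u : nat -> \bar R) : (forall k, 0 <= u k) ->
  (forall e : R, (0 < e)%R -> exists N, forall k, (N <= k)%N -> u k <= e%:E) ->
  u @ \oo --> 0.
Proof.
move=> u0 h; apply: limn_esup_le_cvg => //.
apply/lee_addgt0Pr => e e0; rewrite add0e.
have [N hN] := h e e0.
rewrite limn_esup_lim; apply: lime_le; first exact: is_cvg_esups.
exists N => // k /= Nk; apply: ge_ereal_sup => _ [m /= km <-].
by apply: hN; exact: leq_trans km.
Qed.

End half_line.

(** * The Lorentz quasi-norm through the distribution function *)

Section lorentz_functional.
Context {R : realType} {n : nat}.
Local Notation Rn := 'rV[R]_n.
Local Notation Leb := (leb_space R n).
Local Notation lambda := (@lebn R n).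
Local Notation mu := (@lebesgue_measure R).
Variables p q : R.
Hypotheses (p1 : (1 < p)%R) (q1 : (1 < q)%R).
Implicit Types F : Rn -> \bar R.

Definition distr F (t : R) : \bar R := lambda [set x | t%:E < `|F x|].

Definition lorentz_integrand F (t : R) : \bar R :=
  distr F t `^ (q / p) * (t `^ (q - 1))%:E.

(** This is the q-th power of the L^{p,q} quasi-norm divided by p; estimates are made on it because
    no root intervenes. *)
Definition lorentz_int F : \bar R :=
  \int[mu]_(t in `]0%R, +oo[) lorentz_integrand F t.

Let p0 : (0 < p)%R. Proof. exact: lt_trans ltr01 p1. Qed.
Let q0 : (0 < q)%R. Proof. exact: lt_trans ltr01 q1. Qed.
Let qp0 : (0 < q / p)%R. Proof. exact: divr_gt0. Qed.
Let qp_neq0 : (q / p != 0)%R. Proof. by rewrite gt_eqF. Qed.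
Let q10 : (0 <= q - 1)%R. Proof. by rewrite subr_ge0 ltW. Qed.

Lemma lorentzE F : lorentz p q F = (p `^ q^-1)%:E * lorentz_int F `^ q^-1.
Proof.
congr (_ * _ `^ _); apply: eq_integral => t; rewrite inE/= in_itv/= andbT => t0.
congr (_ * _%:E); rewrite powRB; last by rewrite gt_eqF ?implybT.
by rewrite powRr1// ltW.
Qed.

Lemma distr_ge0 F t : 0 <= distr F t.
Proof. exact: outer_measure_ge0. Qed.

Lemma le_distr F s t : (s <= t)%R -> distr F t <= distr F s.
Proof. by move=> st; apply: le_lebn => x /=; apply: le_lt_trans; rewrite lee_fin. Qed.

Lemma le_distr_pow (a b : \bar R) : 0 <= a -> a <= b -> a `^ (q / p) <= b `^ (q / p).
Proof.
move=> a0 ab; apply: gt0_ler_poweR => //; first exact: ltW.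
  by rewrite in_itv/= a0 leey.
by rewrite in_itv/= (le_trans a0 ab) leey.
Qed.

Lemma lorentz_integrand_ge0 F t : 0 <= lorentz_integrand F t.
Proof. by rewrite mule_ge0 ?poweR_ge0// lee_fin powR_ge0. Qed.

Lemma measurable_distr_pow F : measurable_fun [set: R] (fun t => distr F t `^ (q / p)).
Proof.
apply: nonincreasing_emeasurable => // s t st; apply: le_distr_pow.
  exact: distr_ge0.
exact: le_distr.
Qed.

Lemma measurable_lorentz_integrand F : measurable_fun [set: R] (lorentz_integrand F).
Proof.
apply: emeasurable_funM; first exact: measurable_distr_pow.
apply/measurable_EFinP; exact: measurable_powR.
Qed.

Lemma lorentz_int_ge0 F : 0 <= lorentz_int F.
Proof. by apply: integral_ge0 => t _; exact: lorentz_integrand_ge0. Qed.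

Lemma le_lorentz_int F1 F2 : (forall x, `|F1 x| <= `|F2 x|) ->
  lorentz_int F1 <= lorentz_int F2.
Proof.
move=> h; apply: ge0_le_integral => //.
- by move=> t _; exact: lorentz_integrand_ge0.
- exact: measurable_funTS (measurable_lorentz_integrand _).
- exact: measurable_funTS (measurable_lorentz_integrand _).
- move=> t _; apply: lee_wpmul2r; first by rewrite lee_fin powR_ge0.
  apply: le_distr_pow (distr_ge0 _ _) _; apply: le_lebn => x /= tx.
  exact: lt_le_trans (h x).
Qed.

Lemma lorentz_lty F : lorentz p q F < +oo <-> lorentz_int F < +oo.
Proof.
have c0 : (0 < p `^ q^-1)%R by exact: powR_gt0.
rewrite lorentzE; split => [h|h].
  have : lorentz_int F `^ q^-1 < +oo.
    rewrite ltey; apply/negP => /eqP hy; move: h.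
    by rewrite hy gt0_muley ?lte_fin.
  by apply: lty_poweRy; rewrite invr_eq0 gt_eqF.
by apply: lte_mul_pinfty; rewrite ?lee_fin ?(ltW c0)// poweR_lty.
Qed.

(** Here [d] is e^q / p, the value at which the quasi-norm equals [e]. *)
Lemma lorentz_small (e : R) : (0 < e)%R ->
  exists2 d : R, (0 < d)%R & forall F, lorentz_int F <= d%:E -> lorentz p q F <= e%:E.
Proof.
move=> e0; have c0 : (0 < p `^ q^-1)%R by exact: powR_gt0.
exists ((e / p `^ q^-1) `^ q)%R; first by rewrite powR_gt0// divr_gt0.
move=> F hF; rewrite lorentzE.
apply: (@le_trans _ _ ((p `^ q^-1)%:E * (((e / p `^ q^-1) `^ q)%:E `^ q^-1))).
  apply: lee_wpmul2l; first by rewrite lee_fin ltW.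
  apply: gt0_ler_poweR => //; first by rewrite invr_ge0 ltW.
    by rewrite in_itv/= lorentz_int_ge0 leey.
  by rewrite in_itv/= lee_fin powR_ge0 leey.
rewrite poweR_EFin -powRrM mulfV ?gt_eqF// powRr1 ?divr_ge0 ?(ltW e0) ?(ltW c0)//.
by rewrite -EFinM mulrCA mulfV ?gt_eqF// mulr1.
Qed.

(** Level sets of [c F] at c t are those of [F] at t; the substitution produces c * c^(q-1). *)
Lemma lorentz_intZ (c : R) F : (0 < c)%R ->
  lorentz_int (fun x => c%:E * F x) = (c `^ q)%:E * lorentz_int F.
Proof.
move=> c0; rewrite /lorentz_int.
rewrite (integral_half_line_scale c0); first last.
- exact: lorentz_integrand_ge0.
- exact: measurable_lorentz_integrand.
have dE t : (0 <= t)%R -> lorentz_integrand (fun x => c%:E * F x) (c * t)%R =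
    (c `^ (q - 1))%:E * lorentz_integrand F t.
  move=> t0; rewrite /lorentz_integrand /distr.
  have -> : [set x | (c * t)%:E < `|c%:E * F x|] = [set x | t%:E < `|F x|].
    by apply/seteqP; split => x /=;
      rewrite abseM abse_EFin (gtr0_norm c0) EFinM lte_pmul2l ?lte_fin.
  by rewrite powRM// ?(ltW c0)// EFinM muleCA.
have -> : \int[mu]_(t in `]0%R, +oo[) lorentz_integrand (fun x => c%:E * F x) (c * t)%R
    = \int[mu]_(t in `]0%R, +oo[) ((c `^ (q - 1))%:E * lorentz_integrand F t).
  apply: eq_integral => t; rewrite inE/= in_itv/= andbT => /ltW t0.
  exact: dE.
rewrite ge0_integralZl_EFin//; first last.
- exact: powR_ge0.
- exact: measurable_funTS (measurable_lorentz_integrand F).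
- by move=> t _; exact: lorentz_integrand_ge0.
by rewrite muleA -EFinM mulr_powRB1 ?(ltW c0)// gt_eqF.
Qed.

Lemma poweRD_le (r : R) (a b : \bar R) : (0 <= r)%R -> 0 <= a -> 0 <= b ->
  (a + b) `^ r <= (2 `^ r)%:E * (a `^ r + b `^ r).
Proof.
move=> r0 a0 b0.
wlog ab : a b a0 b0 / a <= b => [hw|].
  by case: (leP a b) => [|/ltW] h; [exact: hw|rewrite addeC (addeC (a `^ r)); exact: hw].
apply: (@le_trans _ _ ((2%:E * b) `^ r)).
  apply: gt0_ler_poweR => //.
  - by rewrite in_itv/= adde_ge0// leey.
  - by rewrite in_itv/= mule_ge0// leey.
  - by rewrite mule_natl mule2n leeD.
rewrite poweRM// poweR_EFin; apply: lee_wpmul2l; first by rewrite lee_fin powR_ge0.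
by rewrite leeDr// poweR_ge0.
Qed.

(** Off a null set, |F| > t forces |2 F1| > t or |2 F2| > t. The factor 2^(q/p) comes from the power
    of a sum of measures, 2^q from the doubled functions. Domination a.e. is enough, so the null
    sets met later are discarded here. *)
Lemma lorentz_intD F1 F2 F :
  {ae lambda, forall x, `|F x| <= `|F1 x| + `|F2 x|} ->
  lorentz_int F <= (2 `^ (q / p) * 2 `^ q)%:E * (lorentz_int F1 + lorentz_int F2).
Proof.
move=> hF.
have dD t : distr F t <= distr (fun x => 2%:E * F1 x) t + distr (fun x => 2%:E * F2 x) t.
  (* The null set where the bound fails is added as a third set, of measure 0. *)
  rewrite -[leRHS]add0e -(negligible_lebn hF).
  rewrite /distr; apply: le_trans (leeD2l _ (lebnU_le _ _)).
  apply: le_trans (lebnU_le _ _); apply: le_lebn => x /= tF.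
  have [h|] := leP `|F x| (`|F1 x| + `|F2 x|); last by move=> _; left.
  right; have [|h1] := ltP t%:E `|2%:E * F1 x|; first by left.
  have [|h2] := ltP t%:E `|2%:E * F2 x|; first by right.
  exfalso; move: {tF h}(lt_le_trans tF h) h1 h2.
  rewrite !abseM !abse_EFin ger0_norm//.
  case: (`|F1 x|) => [a| |]; case: (`|F2 x|) => [b| |];
    rewrite ?gt0_muley ?lte_fin// ?gt0_muleNy ?lte_fin// -?EFinM -?EFinD ?lee_fin ?lte_fin//.
  by move=> h0 h1 h2; lra.
apply: (@le_trans _ _ (\int[mu]_(t in `]0%R, +oo[) ((2 `^ (q / p))%:E *
   (lorentz_integrand (fun x => 2%:E * F1 x) t + lorentz_integrand (fun x => 2%:E * F2 x) t)))).
  apply: ge0_le_integral => //.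
  - by move=> t _; exact: lorentz_integrand_ge0.
  - exact: measurable_funTS (measurable_lorentz_integrand _).
  - by apply: measurable_funeM; apply: emeasurable_funD;
      exact: measurable_funTS (measurable_lorentz_integrand _).
  - move=> t _; rewrite /lorentz_integrand -ge0_muleDl ?poweR_ge0// muleA.
    apply: lee_wpmul2r; first by rewrite lee_fin powR_ge0.
    apply: le_trans (poweRD_le (ltW qp0) (distr_ge0 _ _) (distr_ge0 _ _)).
    exact: le_distr_pow (distr_ge0 _ _) (dD t).
have mI F' : measurable_fun (`]0%R, +oo[%classic : set R) (lorentz_integrand F').
  exact: measurable_funTS (measurable_lorentz_integrand _).
have sum0 t : 0 <= lorentz_integrand (fun x => 2%:E * F1 x) t +
    lorentz_integrand (fun x => 2%:E * F2 x) t.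
  by rewrite adde_ge0// lorentz_integrand_ge0.
rewrite ge0_integralZl_EFin//; last by apply: emeasurable_funD; exact: mI.
rewrite ge0_integralD//; try by [exact: mI|move=> t _; exact: lorentz_integrand_ge0].
rewrite -/(lorentz_int _) -/(lorentz_int _) !lorentz_intZ// -ge0_muleDr ?lorentz_int_ge0//.
by rewrite muleA -EFinM.
Qed.

(** Levels above [M] contribute nothing; below, t^(q-1) is at most M^(q-1), and the interval of
    length [M] gives M^q. *)
Lemma lorentz_int_bound F (S : set Rn) (M : R) : (0 <= M)%R ->
  (forall x, `|F x| <= M%:E) -> (forall x, F x != 0 -> S x) ->
  lorentz_int F <= lambda S `^ (q / p) * (M `^ q)%:E.
Proof.
move=> M0 FM FS.
have mI F' : measurable_fun (`]0%R, M]%classic : set R) (lorentz_integrand F').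
  exact: measurable_funTS (measurable_lorentz_integrand _).
have -> : lorentz_int F = \int[mu]_(t in `]0%R, M]) lorentz_integrand F t.
  rewrite /lorentz_int integral_mkcond [RHS]integral_mkcond.
  apply: eq_integral => t _; rewrite /patch !mem_setE !in_itv/= andbT.
  case: (ltP 0%R t) => //= t0; case: ifPn => // /negP tM.
  rewrite /lorentz_integrand /distr (_ : [set x | _] = set0) ?measure0.
    by rewrite poweR0r// mul0e.
  apply/seteqP; split => x //= tF; apply: tM.
  by rewrite -lee_fin; apply/ltW; exact: lt_le_trans tF (FM x).
apply: (@le_trans _ _ (\int[mu]_(t in `]0%R, M]) (lambda S `^ (q / p) * (M `^ (q - 1))%:E))).
  apply: ge0_le_integral => //.
  - by move=> t _; exact: lorentz_integrand_ge0.
  - exact: mI.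
  - move=> t /=; rewrite in_itv/= => /andP[t0 tM].
    apply: lee_pmul; rewrite ?poweR_ge0 ?lee_fin ?powR_ge0//.
      apply: le_distr_pow (distr_ge0 _ _) _; apply: le_lebn => x /= tF.
      apply: FS; apply/negP => /eqP F0; move: tF.
      by rewrite F0 abse0 lte_fin ltNge (ltW t0).
    by apply: ge0_ler_powR; rewrite ?nnegrE ?(ltW t0).
rewrite integral_cst//= lebesgue_measure_itv/= lte_fin.
case: ifPn => [M0'|].
  by rewrite oppr0 adde0 -muleA -EFinM (mulrC _ M) mulr_powRB1.
by rewrite mule0 mule_ge0 ?poweR_ge0// lee_fin powR_ge0.
Qed.

(** Chebyshev's inequality on the levels in []a, b]], where the distribution function is at least
    its value at [b] and t^(q-1) is at least a^(q-1). *)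
Lemma lorentz_int_lower F (a b : R) : (0 < a)%R -> (a < b)%R ->
  distr F b `^ (q / p) * (a `^ (q - 1) * (b - a))%:E <= lorentz_int F.
Proof.
move=> a0 ab.
apply: (@le_trans _ _ (\int[mu]_(t in `]a, b]) lorentz_integrand F t)); last first.
  apply: ge0_subset_integral => //.
  - exact: measurable_funTS (measurable_lorentz_integrand _).
  - by move=> t _; exact: lorentz_integrand_ge0.
  - by move=> t /=; rewrite !in_itv/= andbT => /andP[/(lt_trans a0)].
apply: (@le_trans _ _ (\int[mu]_(t in `]a, b]) (distr F b `^ (q / p) * (a `^ (q - 1))%:E))).
  by rewrite integral_cst//= lebesgue_measure_itv/= lte_fin ab -muleA -EFinB EFinM.
apply: ge0_le_integral => //.
- by move=> t _; rewrite mule_ge0 ?poweR_ge0// lee_fin powR_ge0.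
- exact: measurable_funTS (measurable_lorentz_integrand _).
- move=> t /=; rewrite in_itv/= => /andP[at_ tb].
  apply: lee_pmul; rewrite ?poweR_ge0 ?lee_fin ?powR_ge0//.
    exact: le_distr_pow (distr_ge0 _ _) (le_distr _ tb).
  by apply: ge0_ler_powR; rewrite ?nnegrE ?(ltW a0) ?(ltW at_)// ltW// (lt_trans a0).
Qed.

Lemma distr_lty F t : lorentz_int F < +oo -> (0 < t)%R -> distr F t < +oo.
Proof.
move=> Ffin t0; have t20 : (0 < t / 2)%R by rewrite divr_gt0.
have tt : (t / 2 < t)%R by rewrite ltr_pdivrMr// ltr_pMr// ltr1n.
have := le_lt_trans (lorentz_int_lower F t20 tt) Ffin.
rewrite !ltey; apply: contra => /eqP ->.
by rewrite poweRyr// gt0_mulye// lte_fin mulr_gt0 ?powR_gt0// subr_gt0.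
Qed.

(** The set where [F] is infinite lies in every level set; letting b grow in [lorentz_int_lower]
    forces its measure to be 0. *)
Lemma lorentz_int_fin_num F : lorentz_int F < +oo ->
  {ae lambda, forall x, F x \is a fin_num}.
Proof.
move=> Ffin; apply: lebn_null; set N := ~` _.
have Nb b : lambda N <= distr F b.
  by apply: le_lebn => x; rewrite /N /=; case: (F x) => [r /(_ isT)//| |] _; rewrite /= ltry.
have [L hL] : exists L : R, lorentz_int F = L%:E.
  exists (fine (lorentz_int F)); rewrite fineK// ge0_fin_numE//.
  exact: lorentz_int_ge0.
have L0 : (0 <= L)%R by rewrite -lee_fin -hL lorentz_int_ge0.
have low b : (1 < b)%R -> lambda N `^ (q / p) * (b - 1)%:E <= L%:E.
  move=> b1; rewrite -hL; apply: le_trans (lorentz_int_lower F ltr01 b1).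
  rewrite powR1 mul1r; apply: lee_wpmul2r; first by rewrite lee_fin subr_ge0 ltW.
  exact: le_distr_pow (outer_measure_ge0 _ _) (Nb b).
apply/eqP/negPn/negP => N0.
have : 0 < lambda N `^ (q / p) by rewrite poweR_gt0// lt_neqAle eq_sym N0 outer_measure_ge0.
move: low; case: (lambda N `^ (q / p)) => [v low v0|low _|//].
  have v0' : (0 < v)%R by rewrite -lte_fin.
  (* Chosen so that v * (b - 1) = L + 1 exceeds [L]. *)
  have b1 : (1 < 1 + (L + 1) / v)%R by rewrite ltrDl divr_gt0// ltr_wpDl.
  have := low _ b1; rewrite addrAC subrr add0r -EFinM mulrCA mulfV ?gt_eqF//.
  by rewrite mulr1 lee_fin; lra.
have b1 : (1 < 2 :> R)%R by rewrite ltr1n.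
by have := low _ b1; rewrite gt0_mulye ?leye_eq// lte_fin subr_gt0.
Qed.

(** Here [F \_ (A k)] is the part of [F] cut away. At each level t > 0 the distribution function of
    [F] is finite, so continuity from above sends that of the cut part to 0; [lorentz_integrand F]
    dominates. *)
Lemma lorentz_int_truncate F (A : nat -> set Rn) (d : R) :
  lebesgue_measurable F -> lorentz_int F < +oo ->
  (forall k, (@measurable _ Leb) (A k)) -> (forall k, A k.+1 `<=` A k) ->
  lambda (\bigcap_k A k) = 0 -> (0 < d)%R ->
  exists k, lorentz_int (F \_ (A k)) <= d%:E.
Proof.
move=> mF Ffin mA ndA A0 d0.
have dE k t : (0 <= t)%R -> distr (F \_ (A k)) t = lambda ([set x | t%:E < `|F x|] `&` A k).
  move=> t0; congr lebn; apply/seteqP; split => x /=; rewrite /patch.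
    case: ifPn => [/set_mem//|_]; rewrite abse0 lte_fin ltNge t0//.
  by move=> [tF Ak]; rewrite mem_set.
have mI F' : measurable_fun (`]0%R, +oo[%classic : set R) (lorentz_integrand F').
  exact: measurable_funTS (measurable_lorentz_integrand _).
have mT t : (@measurable _ Leb) [set x | t%:E < `|F x|].
  have maF : measurable_fun [set: Leb] ((fun x : Rn => `|F x|) : Leb -> \bar R).
    exact: measurableT_comp mF.
  by have := @emeasurable_fun_o_infty _ Leb R setT _ measurableT maF t%:E; rewrite setTI.
have niA : nonincreasing_seq (A : (set Leb)^nat).
  by apply/nonincreasing_seqP => k; apply/subsetPset; exact: ndA.
have cvgd t : (0 < t)%R -> (fun k => distr (F \_ (A k)) t) @ \oo --> 0.
  move=> t0.
  have -> : (fun k => distr (F \_ (A k)) t) =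
      lambda \o (fun k => [set x | t%:E < `|F x|] `&` A k).
    by apply/funext => k; rewrite dE// ltW.
  have <- : lambda (\bigcap_k ([set x | t%:E < `|F x|] `&` A k)) = 0.
    apply/eqP; rewrite eq_le outer_measure_ge0 andbT -A0.
    by apply: le_lebn => x h k _; have [] := h k I.
  apply: (@nonincreasing_cvg_mu _ Leb).
  - apply: le_lt_trans (distr_lty Ffin t0); apply: le_lebn; exact: subIsetl.
  - by move=> k; exact: measurableI.
  - by apply: bigcapT_measurable => k; exact: measurableI.
  - by move=> a b ab; apply/subsetPset; apply: setIS; exact/subsetPset/niA.
have H3 : {ae mu, forall t, (`]0%R, +oo[%classic : set R) t ->
    (fun k => lorentz_integrand (F \_ (A k)) t) @ \oo --> (cst 0 t : \bar R)}.
  apply: aeW => t /=; rewrite in_itv/= andbT => t0.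
  apply: cvge0P => [k|e e0]; first exact: lorentz_integrand_ge0.
  have c0 : (0 < t `^ (q - 1))%R by exact: powR_gt0.
  (* Solves e'^(q/p) * t^(q-1) = e. *)
  pose e' := ((e / t `^ (q - 1)) `^ (q / p)^-1)%R.
  have e'0 : (0 < e')%R by rewrite powR_gt0// divr_gt0.
  have /(cvgd _ t0)[N _ hN] : nbhs (0 : \bar R) [set y | y < e'%:E].
    by apply: open_nbhs_nbhs; split; [exact: open_ereal_lt_ereal|rewrite /= lte_fin].
  exists N => k Nk; have /ltW hk := hN k Nk.
  apply: (@le_trans _ _ (e'%:E `^ (q / p) * (t `^ (q - 1))%:E)).
    apply: lee_wpmul2r; first by rewrite lee_fin ltW.
    exact: le_distr_pow (distr_ge0 _ _) hk.
  rewrite poweR_EFin -powRrM mulVf// powRr1 ?divr_ge0 ?(ltW e0) ?(ltW c0)//.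
  by rewrite -EFinM divfK// gt_eqF.
have H4 : mu.-integrable (`]0%R, +oo[%classic : set R) (lorentz_integrand F).
  apply/integrableP; split; first exact: mI.
  by under eq_integral do rewrite (gee0_abs (lorentz_integrand_ge0 _ _)).
have H5 : {ae mu, forall t k, (`]0%R, +oo[%classic : set R) t ->
    `|lorentz_integrand (F \_ (A k)) t| <= lorentz_integrand F t}.
  apply: aeW => t k /=; rewrite in_itv/= andbT => /ltW t0.
  rewrite gee0_abs ?lorentz_integrand_ge0//.
  apply: lee_wpmul2r; first by rewrite lee_fin powR_ge0.
  apply: le_distr_pow (distr_ge0 _ _) _.
  by rewrite dE//; apply: le_lebn; exact: subIsetl.
have [_ _] := @dominated_convergence _ (measurableTypeR R) R mu
  (`]0%R, +oo[%classic : set R) (measurable_itv _)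
  (fun k => lorentz_integrand (F \_ (A k))) (cst 0) (lorentz_integrand F)
  (fun k => mI _) (measurable_cst _) H3 H4 H5.
rewrite integral0 => cvgI.
have /cvgI[N _ hN] : nbhs (0 : \bar R) [set y | y < d%:E].
  by apply: open_nbhs_nbhs; split; [exact: open_ereal_lt_ereal|rewrite /= lte_fin].
by exists N; apply/ltW; exact: (hN N (leqnn N)).
Qed.

End lorentz_functional.

(** * Distance to a set *)

Section distance_to_set.
Context {R : realType} {V : normedModType R}.
Variable A : set V.
Hypothesis A0 : A !=set0.

Definition setdist (x : V) : R := inf [set `|x - z|%R | z in A].

Let hasinf x : has_lbound [set `|x - z|%R | z in A].
Proof. by exists 0%R => _ [z _ <-]; exact: normr_ge0. Qed.

Let ne x : [set `|x - z|%R | z in A] !=set0.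
Proof. by have [z Az] := A0; exists `|x - z|%R, z. Qed.

Lemma setdist_le x z : A z -> (setdist x <= `|x - z|)%R.
Proof. by move=> Az; apply: ge_inf => //; exists z. Qed.

Lemma le_setdist x r : (forall z, A z -> r <= `|x - z|)%R -> (r <= setdist x)%R.
Proof. by move=> h; apply: lb_le_inf => // _ [z Az <-]; exact: h. Qed.

Lemma setdist_ge0 x : (0 <= setdist x)%R.
Proof. exact: le_setdist. Qed.

Lemma setdist0 x : A x -> setdist x = 0%R.
Proof.
move=> Ax; apply/eqP; rewrite eq_le setdist_ge0 andbT.
by apply: le_trans (setdist_le x Ax) _; rewrite subrr normr0.
Qed.

Lemma setdist_triangle x y : (setdist x <= `|x - y| + setdist y)%R.
Proof.
rewrite -lerBlDl; apply: le_setdist => z Az; rewrite lerBlDl.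
by apply: le_trans (setdist_le x Az) _; exact: ler_distD.
Qed.

Lemma setdist_continuous : continuous setdist.
Proof.
move=> x; apply/cvgrPdist_le => e e0; near=> y.
have xy : (`|x - y| <= e)%R.
  near: y; apply/nbhs_ballP; exists e => // y; rewrite -ball_normE /ball_/=.
  exact: ltW.
apply: le_trans xy; rewrite ler_distl lerBlDr !(addrC (setdist _)).
by rewrite {1}(distrC x) !setdist_triangle.
Unshelve. all: by end_near. Qed.

Lemma setdist_gt0 x : closed A -> ~ A x -> (0 < setdist x)%R.
Proof.
move=> cA nAx; have /nbhs_ballP[e /= e0 xe] : nbhs x (~` A).
  by apply: open_nbhs_nbhs; split => //; exact: closed_openC.
apply: lt_le_trans e0 _; apply: le_setdist => z Az.
rewrite leNgt; apply/negP => xz; apply: (xe z) => //.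
by rewrite -ball_normE.
Qed.

End distance_to_set.

(** * Approximation of bounded functions by C_0 in L^{p,q} *)

Section continuous_approximation.
Context {R : realType} {n : nat}.
Local Notation Rn := 'rV[R]_n.
Local Notation Leb := (leb_space R n).
Local Notation lambda := (@lebn R n).
Variables p q : R.
Hypotheses (p1 : (1 < p)%R) (q1 : (1 < q)%R).

Let p0 : (0 < p)%R. Proof. exact: lt_trans ltr01 p1. Qed.
Let q0 : (0 < q)%R. Proof. exact: lt_trans ltr01 q1. Qed.
Let qp0 : (0 < q / p)%R. Proof. exact: divr_gt0. Qed.

Local Notation cube r := [set x : Rn | (`|x| <= r)%R].
Local Notation lint := (@lorentz_int R n p q).

Definition vanishes_off (r : R) (h : Rn -> R) := forall x, (r < `|x|)%R -> h x = 0%R.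

(** The ball of radius [r] does not depend on [d]: to be multiples of blocks, the errors must live
    on a set of controlled capacity. *)
Definition approximable (r : R) (h : Rn -> R) := forall d : R, (0 < d)%R ->
  exists g : Rn -> R, [/\ continuous g, vanishes_off r g &
    lint (fun x => (h x - g x)%:E) <= d%:E].

Lemma Cc_vanishes_off (r : R) (g : Rn -> R) :
  continuous g -> vanishes_off r g -> Cc g.
Proof.
move=> cg gr; split => //.
have cB : closed (cube r).
  have : closed ((fun x : Rn => `|x|%R) @^-1` [set t : R | (t <= r)%R]).
    by apply: closed_comp => [x _|]; [exact: norm_continuous|exact: closed_le].
  exact.
have sub : closure [set x | g x != 0%R] `<=` cube r.
  rewrite (proj1 (closure_id _) cB); apply: closureS => x /= gx.
  by rewrite leNgt; apply/negP => /gr; apply/eqP.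
apply: bounded_closed_compact; last exact: closed_closure.
exists r; split => [|M rM x /sub /= xr]; first exact: num_real.
exact: le_trans xr (ltW rM).
Qed.

Lemma Cc_vanishesP (g : Rn -> R) : Cc g -> exists r, vanishes_off r g.
Proof.
move=> [cg /compact_bounded[M [Mreal hM]]]; exists (M + 1)%R => x xM.
apply/eqP/negPn/negP => gx.
have cx : closure [set x | g x != 0%R] x by exact: subset_closure.
have := hM (M + 1)%R _ x cx.
by rewrite ltrDl ltr01 => /(_ isT) /=; rewrite leNgt xM.
Qed.

(** With U open around A, min(m dist(x, U^c), 1) differs from the indicator of A only on U \ A and
    on the shell of U where the distance is below 1/m. The shells decrease to the empty set, so no
    compact set inside A is called for. *)
Lemma urysohn_approx (A : set Rn) (r e : R) : (@measurable _ Leb) A ->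
  (forall x, A x -> (`|x| <= r)%R) -> (0 < e)%R ->
  exists g : Rn -> R, [/\ continuous g, vanishes_off (r + 1) g,
    (forall x, 0 <= g x <= 1)%R & lambda [set x | g x != \1_A x] <= e%:E].
Proof.
move=> mA Ar e0.
have e20 : (0 < e / 2)%R by rewrite divr_gt0.
have Afin : lambda A < +oo by apply: le_lt_trans (lebn_bounded r); exact: le_lebn.
have [U0 [oU0 AU0 lU0]] := lebn_outer_regular e20 Afin.
pose B := [set x : Rn | (`|x| < r + 1)%R].
(* Intersecting with a ball one unit larger keeps the support bounded; hence the radius [r + 1]. *)
pose U := U0 `&` B.
have oB : open B.
  have : open ((fun x : Rn => `|x|%R) @^-1` [set t : R | (t < r + 1)%R]).
    by apply: open_comp => [x _|]; [exact: norm_continuous|exact: open_lt].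
  exact.
have oU : open U by exact: openI.
have AU : A `<=` U.
  by move=> x Ax; split; [exact: AU0|rewrite /B/= (le_lt_trans (Ar _ Ax))// ltrDl].
have lU : lambda U <= lambda A + (e / 2)%:E.
  by apply: le_trans lU0; apply: le_lebn; exact: subIsetl.
have mU : (@measurable _ Leb) U by exact: open_measurable_leb.
have lUA : lambda (U `\` A) <= (e / 2)%:E.
  have Ufin : lambda U < +oo by apply: le_lt_trans lU _; rewrite lte_add_pinfty ?ltry.
  rewrite measureD//.
  rewrite leeBlDr; last first.
    by rewrite ge0_fin_numE//; apply: le_lt_trans Afin; apply: le_lebn; exact: subIsetr.
  by rewrite (setIidr AU) addeC.
(* The distance presupposes a nonempty set. As [U] lies in a ball, its complement is empty only in
   dimension 0. *)
have [UC0|/set0P UC0] := eqVneq (~` U) set0.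
  exists (cst 1%R); split.
  - exact: cst_continuous.
  - move=> x rx; have : U x by rewrite -(setCK U) UC0 setC0.
    by move=> [_]; rewrite /B/= ltNge (ltW rx).
  - by move=> x; rewrite ler01 lexx.
  - apply: (@le_trans _ _ (lambda (U `\` A))).
      apply: le_lebn => x /= hx; split; first by rewrite -(setCK U) UC0 setC0.
      by move=> Ax; move: hx; rewrite indicE mem_set// eqxx.
    by apply: le_trans lUA _; rewrite lee_fin; lra.
pose d := setdist (~` U).
have cd : continuous d by exact: setdist_continuous.
have d_gt0 x : U x -> (0 < d x)%R.
  by move=> Ux; apply: setdist_gt0 => //; exact: open_closedC.
pose V k := U `&` [set x | (d x < k.+1%:R^-1)%R].
have mV k : (@measurable _ Leb) (V k).
  apply: measurableI => //; apply: open_measurable_leb.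
  have : open (d @^-1` [set t : R | (t < k.+1%:R^-1)%R]).
    by apply: open_comp => [x _|]; [exact: cd|exact: open_lt].
  exact.
have V0 : \bigcap_k V k = set0.
  apply/seteqP; split => // x h; have [Ux _] := h 0%N I.
  have /ltr_add_invr[k] := d_gt0 _ Ux; rewrite add0r => hk.
  by have [_ /= /(lt_trans hk)] := h k I; rewrite ltxx.
have : lambda \o V @ \oo --> lambda (\bigcap_k V k).
  apply: (@nonincreasing_cvg_mu _ Leb).
  - apply: (@le_lt_trans _ _ (lambda U)); first by apply: le_lebn; exact: subIsetl.
    by apply: le_lt_trans lU _; rewrite lte_add_pinfty// ltry.
  - exact: mV.
  - exact: bigcapT_measurable.
  - move=> a b ab; apply/subsetPset => x [Ux] /= dx; split => //=.
    by apply: lt_le_trans dx _; rewrite lef_pV2 ?posrE// ler_nat ltnS.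
rewrite V0 measure0 => cvgV.
have /cvgV[N _ hN] : nbhs (0 : \bar R) [set y | y < (e / 2)%:E].
  by apply: open_nbhs_nbhs; split; [exact: open_ereal_lt_ereal|rewrite /= lte_fin].
have /ltW lVN := hN N (leqnn N).
exists (fun x => Num.min (N.+1%:R * d x) 1)%R; split.
- move=> x; apply: (@continuous_min R Rn (fun x => N.+1%:R * d x)%R (cst 1%R) x).
    apply: (@continuousM R Rn (cst N.+1%:R)%R d x); [exact: cst_continuous|exact: cd].
  exact: cst_continuous.
- move=> x rx; rewrite /d setdist0 ?mulr0 ?min_l//.
  by move=> [_]; rewrite /B /= ltNge (ltW rx).
- move=> x; rewrite le_min ler01 andbT mulr_ge0 ?setdist_ge0//=.
  by rewrite ge_min lexx orbT.
- apply: (@le_trans _ _ (lambda ((U `\` A) `|` V N))).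
    apply: le_lebn => x /= hx.
    have [Ux|nUx] := pselect (U x); last first.
      exfalso; move: hx; rewrite /d setdist0// mulr0 min_l// indicE memNset ?eqxx//.
      by move=> /AU.
    have [Ax|nAx] := pselect (A x); last by left.
    right; split => //=; rewrite ltNge; apply/negP => hd; move: hx.
    rewrite indicE mem_set// min_r ?eqxx//.
    by rewrite mulrC -ler_pdivrMr// mul1r.
  apply: le_trans (lebnU_le _ _) _; apply: le_trans (leeD lUA lVN) _.
  by rewrite -EFinD -splitr.
Qed.

Let K := (2 `^ (q / p) * 2 `^ q)%R.
Let K0 : (0 < K)%R. Proof. by rewrite mulr_gt0// powR_gt0. Qed.

Lemma lorentz_intD_small (F1 F2 F : Rn -> \bar R) (d : R) :
  {ae lambda, forall x, `|F x| <= `|F1 x| + `|F2 x|} ->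
  lint F1 <= (d / (2 * (2 `^ (q / p) * 2 `^ q)))%:E ->
  lint F2 <= (d / (2 * (2 `^ (q / p) * 2 `^ q)))%:E -> lint F <= d%:E.
Proof.
move=> hF h1 h2; apply: le_trans (lorentz_intD p1 q1 hF) _.
rewrite -/K in h1 h2 *.
apply: (@le_trans _ _ (K%:E * ((d / (2 * K))%:E + (d / (2 * K))%:E))).
  by apply: lee_wpmul2l; [rewrite lee_fin ltW|exact: leeD].
rewrite -EFinD -EFinM lee_fin le_eqVlt; apply/orP; left; apply/eqP.
by field; rewrite gt_eqF.
Qed.

Let dK_gt0 (d : R) : (0 < d)%R -> (0 < d / (2 * (2 `^ (q / p) * 2 `^ q)))%R.
Proof. by move=> d0; rewrite divr_gt0// mulr_gt0. Qed.

Lemma approximableD (r : R) (h1 h2 : Rn -> R) :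
  approximable r h1 -> approximable r h2 -> approximable r (fun x => h1 x + h2 x)%R.
Proof.
move=> a1 a2 d d0.
have [g1 [cg1 z1 l1]] := a1 _ (dK_gt0 d0); have [g2 [cg2 z2 l2]] := a2 _ (dK_gt0 d0).
exists (fun x => g1 x + g2 x)%R; split.
- by move=> x; apply: continuousD; [exact: cg1|exact: cg2].
- by move=> x rx; rewrite z1// z2// addr0.
- apply: lorentz_intD_small l1 l2; apply: aeW => x.
  rewrite !abse_EFin -EFinD lee_fin.
  rewrite (_ : h1 x + h2 x - (g1 x + g2 x) = (h1 x - g1 x) + (h2 x - g2 x))%R.
    exact: ler_normD.
  by ring.
Qed.

Lemma approximableZ (r c : R) (h : Rn -> R) :
  approximable r h -> approximable r (fun x => c * h x)%R.
Proof.
(* Scaling by [|c| + 1] rather than [|c|] covers c = 0. *)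
move=> ah d d0; have c1 : (0 < `|c| + 1)%R by rewrite ltr_wpDl.
have [|g [cg zg lg]] := ah (d / (`|c| + 1) `^ q)%R.
  by rewrite divr_gt0// powR_gt0.
exists (fun x => c * g x)%R; split.
- move=> x; apply: (@continuousM R Rn (cst c) g x); [exact: cst_continuous|exact: cg].
- by move=> x rx; rewrite zg// mulr0.
- apply: (@le_trans _ _ (lint (fun x => (`|c| + 1)%:E * (h x - g x)%:E))).
    apply: le_lorentz_int => // x.
    rewrite -EFinM !abse_EFin lee_fin -mulrBr !normrM ler_wpM2r//.
    by rewrite (ger0_norm (ltW c1)) lerDl.
  rewrite lorentz_intZ//; apply: (@le_trans _ _ (((`|c| + 1) `^ q)%:E * (d / (`|c| + 1) `^ q)%:E)).
    by apply: lee_wpmul2l lg; rewrite lee_fin powR_ge0.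
  by rewrite -EFinM lee_fin mulrCA mulfV ?mulr1// gt_eqF// powR_gt0.
Qed.

Lemma approximable_indic (A : set Rn) (r : R) : (@measurable _ Leb) A ->
  (forall x, A x -> (`|x| <= r)%R) -> approximable (r + 1) (\1_A : Rn -> R).
Proof.
move=> mA Ar d d0.
(* The error is at most 1 on a set of at most this measure, whose power q / p is [d]. *)
have [|g [cg zg g01 lg]] := urysohn_approx mA Ar (e := (d `^ (q / p)^-1)%R).
  exact: powR_gt0.
exists g; split => //.
apply: (@le_trans _ _ (lambda [set x | g x != \1_A x] `^ (q / p) * (1 `^ q)%:E)).
  apply: lorentz_int_bound => //.
  - move=> x; rewrite abse_EFin lee_fin indicE ler_norml.
    by have /andP[h1 h2] := g01 x; case: (_ \in _) => /=; apply/andP; split; lra.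
  - by move=> x /=; rewrite eqe subr_eq0 eq_sym.
rewrite powR1 mule1; apply: (@le_trans _ _ ((d `^ (q / p)^-1)%:E `^ (q / p))).
  exact: le_distr_pow (outer_measure_ge0 _ _) lg.
by rewrite poweR_EFin -powRrM mulVf ?gt_eqF// powRr1// ltW.
Qed.

Lemma approximable0 (r : R) : approximable r (fun=> 0%R).
Proof.
move=> d d0; exists (fun=> 0%R); split => //; first exact: cst_continuous.
apply: (@le_trans _ _ (lambda set0 `^ (q / p) * (0 `^ q)%:E)).
  by apply: lorentz_int_bound => // x; rewrite subrr ?abse0 ?eqxx.
by rewrite measure0 poweR0r ?gt_eqF// mul0e lee_fin ltW.
Qed.

(* Peeling off the level [e] lowers the bound on [h] from [j.+2 * e] to [j.+1 * e]. *)
Lemma uniform_approximation (r e : R) (j : nat) (h : Rn -> R) : (0 < e)%R ->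
  measurable_fun [set: Leb] (h : Leb -> R) -> vanishes_off r h ->
  (forall x, `|h x| <= j.+1%:R * e)%R ->
  exists s : Rn -> R, [/\ approximable (r + 1) s, vanishes_off r s &
    forall x, (`|h x - s x| <= e)%R].
Proof.
move=> e0; elim: j h => [|j IHj] h mh zh bh.
  exists (fun=> 0%R); split => //; first exact: approximable0.
  by move=> x; rewrite subr0; have := bh x; rewrite mul1r.
pose Ap := [set x | (e <= h x)%R]; pose An := [set x | (h x <= - e)%R].
have mAp : (@measurable _ Leb) Ap.
  have -> : Ap = [set: Leb] `&` h @^-1` `[e, +oo[%classic.
    by apply/seteqP; split => x; rewrite /Ap /= in_itv/= andbT => // -[].
  exact: mh measurableT _ (measurable_itv _).
have mAn : (@measurable _ Leb) An.
  have -> : An = [set: Leb] `&` h @^-1` `]-oo, (- e)%R]%classic.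
    by apply/seteqP; split => x; rewrite /An /= in_itv/= => // -[].
  exact: mh measurableT _ (measurable_itv _).
(* One layer, with values e, 0 and -e. As [e] is positive and [h] vanishes off the ball, both level
   sets lie in the ball, so their indicators are approximable. *)
pose t x := (e * \1_Ap x + (- e) * \1_An x)%R.
have tE x : t x = (if e <= h x then e else if h x <= - e then - e else 0)%R.
  rewrite /t !indicE; case: ifPn => hx.
    rewrite mem_set// memNset ?mulr1 ?mulr0 ?addr0// /An /=; apply/negP.
    by rewrite -ltNge; lra.
  rewrite (@memNset _ Ap); last exact/negP.
  case: ifPn => hx'; first by rewrite mem_set// mulr0 add0r mulr1.
  by rewrite memNset ?mulr0 ?addr0//; exact/negP.
have zt : vanishes_off r t.
  move=> x rx; rewrite tE zh//; case: ifPn => [|_]; first by lra.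
  by case: ifPn => // ; lra.
have bt x : (t x != 0 -> `|x| <= r)%R.
  by move=> tx; rewrite leNgt; apply/negP => /zt/eqP; rewrite (negPf tx).
have [||x|s [as_ zs bs]] := IHj (fun x => h x - t x)%R.
- have mt : measurable_fun [set: Leb] (t : Leb -> R).
    apply: measurable_funD.
      by apply: (@measurable_funM _ Leb R setT (cst e) \1_Ap); [exact: measurable_cst|exact: measurable_indic].
    by apply: (@measurable_funM _ Leb R setT (cst (- e)%R) \1_An); [exact: measurable_cst|exact: measurable_indic].
  exact: measurable_funB mh mt.
- by move=> x rx; rewrite zh// zt// subrr.
- have := bh x; rewrite tE; rewrite !ler_norml => /andP[].
  rewrite -(natr1 j.+1) mulrDl mul1r => h1 h2.
  have je : (0 <= j.+1%:R * e)%R by rewrite mulr_ge0// ltW.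
  have je' : (e <= j.+1%:R * e)%R by rewrite ler_peMl ?(ltW e0)// ler1n.
  case: ifPn => [h3|]; first by apply/andP; split; lra.
  rewrite -ltNge => h3; case: ifPn => [h4|]; first by apply/andP; split; lra.
  by rewrite -ltNge => h4; apply/andP; split; lra.
exists (fun x => t x + s x)%R; split.
- apply: approximableD as_; apply: approximableD; apply: approximableZ;
    apply: approximable_indic => // x Ax.
    by rewrite leNgt; apply/negP => /zh; move: Ax; rewrite /Ap/= => + h0; rewrite h0; lra.
  by rewrite leNgt; apply/negP => /zh; move: Ax; rewrite /An/= => + h0; rewrite h0; lra.
- by move=> x rx; rewrite zt// zs// addr0.
- by move=> x; rewrite opprD addrA; exact: bs.
Qed.

Lemma approximable_bounded (r M : R) (h : Rn -> R) :
  measurable_fun [set: Leb] (h : Leb -> R) -> vanishes_off r h ->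
  (forall x, `|h x| <= M)%R -> approximable (r + 1) h.
Proof.
move=> mh zh bh d d0.
pose v := fine (lambda (cube r)).
have vE : lambda (cube r) = v%:E by rewrite fineK// ge0_fin_numE// lebn_bounded.
pose w := (v `^ (q / p))%R; have w0 : (0 <= w)%R by exact: powR_ge0.
have d'0 := dK_gt0 d0; set d' := (d / _)%R in d'0.
(* Makes w * e^q at most d', where w * e^q bounds the functional of a function of size [e] on the
   ball; w + 1 avoids a division by 0. *)
pose e := ((d' / (w + 1)) `^ q^-1)%R.
have w1 : (0 < w + 1)%R by rewrite ltr_wpDl.
have e0 : (0 < e)%R by rewrite powR_gt0// divr_gt0.
pose j := Num.truncn (M / e).
have bj x : (`|h x| <= j.+1%:R * e)%R.
  apply: le_trans (bh x) _; rewrite -ler_pdivrMr//.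
  exact/ltW/truncnS_gt.
have [s [as_ zs bs]] := uniform_approximation e0 mh zh bj.
have [g [cg zg lg]] := as_ _ d'0.
exists g; split => //; apply: (lorentz_intD_small (F1 := fun x => (h x - s x)%:E) _ _ lg).
  apply: aeW => x; rewrite !abse_EFin -EFinD lee_fin.
  exact: ler_distD.
apply: (@le_trans _ _ (lambda (cube r) `^ (q / p) * (e `^ q)%:E)).
  apply: lorentz_int_bound => //; first exact: ltW.
  move=> x hx /=; rewrite leNgt; apply/negP => rx; move: hx.
  by rewrite zh// zs// subrr eqxx.
rewrite vE poweR_EFin -EFinM lee_fin -powRrM mulVf ?gt_eqF// powRr1; last first.
  by rewrite divr_ge0// ltW.
by rewrite -/w -/d' mulrCA ler_piMr ?(ltW d'0)// ler_pdivrMr// mul1r lerDl.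
Qed.

End continuous_approximation.

(** * Almost-everywhere reasoning, C_0 and the Lorentz functional *)

Section lebn_almost_everywhere.
Context {R : realType} {n : nat}.
Local Notation Leb := (leb_space R n).
Local Notation lambda := (@lebn R n).

Lemma lebn_aeS (P Q : Leb -> Prop) : (forall x, P x -> Q x) ->
  {ae lambda, forall x, P x} -> {ae lambda, forall x, Q x}.
Proof. by move=> PQ; apply: negligibleS => x /=; apply: contra_not; exact: PQ. Qed.

Lemma lebn_aeS2 (P Q S : Leb -> Prop) : (forall x, P x -> Q x -> S x) ->
  {ae lambda, forall x, P x} -> {ae lambda, forall x, Q x} -> {ae lambda, forall x, S x}.
Proof.
move=> PQS hP hQ; apply: negligibleS (negligibleU hP hQ) => x /= nS.
have [px|] := pselect (P x); last by left.
by right => qx; apply: nS; exact: PQS.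
Qed.

End lebn_almost_everywhere.

Section Cc_functions.
Context {R : realType} {n : nat}.
Local Notation Rn := 'rV[R]_n.
Local Notation Leb := (leb_space R n).
Local Notation lambda := (@lebn R n).
Implicit Types g : Rn -> R.

Lemma Cc_continuous g : Cc g -> continuous g. Proof. by case. Qed.

Lemma Cc_bounded g : Cc g -> exists M, forall x, (`|g x| <= M)%R.
Proof.
move=> [cg cptg].
have : compact (g @` closure [set x | g x != 0%R]).
  by apply: continuous_compact => //; exact: continuous_subspaceT.
move=> /(@compact_bounded _ R^o)[M [Mreal hM]].
exists (`|M| + 1)%R => x; have [->|gx] := eqVneq (g x) 0%R.
  by rewrite normr0 addr_ge0.
apply: (hM (`|M| + 1)%R); first by have := ler_norm M; lra.
by exists x => //; exact: subset_closure.
Qed.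

Lemma Cc0 : Cc (fun _ : Rn => 0%R : R).
Proof. by apply: (@Cc_vanishes_off R n 0%R) => //; exact: cst_continuous. Qed.

Lemma CcD g1 g2 : Cc g1 -> Cc g2 -> Cc (fun x => g1 x + g2 x)%R.
Proof.
move=> c1 c2; have [r1 h1] := Cc_vanishesP c1; have [r2 h2] := Cc_vanishesP c2.
apply: (@Cc_vanishes_off R n (Num.max r1 r2)).
  by move=> x; apply: continuousD; [exact: (Cc_continuous c1)|exact: (Cc_continuous c2)].
by move=> x; rewrite gt_max => /andP[/h1 -> /h2 ->]; rewrite addr0.
Qed.

Lemma CcZ (c : R) g : Cc g -> Cc (fun x => c * g x)%R.
Proof.
move=> cg; have [r h] := Cc_vanishesP cg.
apply: (@Cc_vanishes_off R n r) => [x|x /h ->]; last by rewrite mulr0.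
apply: (@continuousM R Rn (cst c) g x); first exact: cst_continuous.
exact: (Cc_continuous cg).
Qed.

Lemma Cc_sum (m : nat) (l : nat -> R) (g : nat -> Rn -> R) :
  (forall k, Cc (g k)) -> Cc (fun x => \sum_(0 <= k < m) l k * g k x)%R.
Proof.
move=> cg; elim: m => [|m IHm].
  by under eq_fun do rewrite big_nil; exact: Cc0.
under eq_fun do rewrite big_nat_recr//=.
by apply: CcD => //; exact: CcZ.
Qed.

Lemma Cc_measurable g : Cc g -> lebesgue_measurable (EFin \o g).
Proof.
by move=> /Cc_continuous cg; apply/measurable_EFinP; exact: continuous_measurable_leb.
Qed.

End Cc_functions.

Section lorentz_norm.
Context {R : realType} {n : nat}.
Local Notation Rn := 'rV[R]_n.
Local Notation Leb := (leb_space R n).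
Local Notation lambda := (@lebn R n).
Variables p q : R.
Hypotheses (p1 : (1 < p)%R) (q1 : (1 < q)%R).
Local Notation lint := (@lorentz_int R n p q).

Let p0 : (0 < p)%R. Proof. exact: lt_trans ltr01 p1. Qed.
Let q0 : (0 < q)%R. Proof. exact: lt_trans ltr01 q1. Qed.

Lemma lorentzZ (c : R) (F : Rn -> \bar R) : (0 < c)%R ->
  lorentz p q (fun x => c%:E * F x) = c%:E * lorentz p q F.
Proof.
move=> c0; rewrite !lorentzE// lorentz_intZ// poweRM ?lee_fin ?powR_ge0 ?lorentz_int_ge0//.
rewrite poweR_EFin -powRrM mulfV ?gt_eqF// powRr1 ?(ltW c0)//.
by rewrite muleCA.
Qed.

Lemma lorentz_int_ae0 (F : Rn -> \bar R) :
  {ae lambda, forall x, F x = 0} -> lint F = 0.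
Proof.
move=> F0; have l0 : lint (cst 0) = 0.
  apply/eqP; rewrite eq_le lorentz_int_ge0 andbT.
  apply: le_trans (lorentz_int_bound p1 q1 (S := set0) (lexx 0%R) _ _) _.
  - by move=> x; rewrite abse0.
  - by move=> x /=; rewrite eqxx.
  - by rewrite measure0 poweR0r ?mul0e// gt_eqF// divr_gt0.
apply/eqP; rewrite eq_le lorentz_int_ge0 andbT.
apply: (le_trans (lorentz_intD p1 q1 (F1 := cst 0) (F2 := cst 0) _)).
  by apply: lebn_aeS F0 => x ->; rewrite abse0 adde0.
by rewrite l0 adde0 mule0.
Qed.

Lemma Cc_lorentz_int (g : Rn -> R) : Cc g -> lint (EFin \o g) < +oo.
Proof.
move=> cg; have [r hr] := Cc_vanishesP cg; have [M hM] := Cc_bounded cg.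
have M0 : (0 <= M)%R by apply: le_trans (hM 0%R).
apply: (le_lt_trans (lorentz_int_bound p1 q1 (S := [set x | (`|x| <= r)%R]) M0 _ _)).
- by move=> x; rewrite abse_EFin lee_fin.
- move=> x /=; rewrite eqe => gx; rewrite leNgt; apply/negP => /hr /eqP.
  by rewrite (negPf gx).
- by rewrite lte_mul_pinfty ?poweR_ge0 ?ltry ?fin_num_poweR// ge0_fin_numE// lebn_bounded.
Qed.

End lorentz_norm.

(** * Density in the block space *)

Section block_space.
Context {R : realType} {n : nat}.
Local Notation Rn := 'rV[R]_n.
Local Notation Leb := (leb_space R n).
Local Notation lambda := (@lebn R n).
Variables (alpha s : R) (G : Rn -> R).
Hypotheses (hG : is_bessel_kernel alpha G) (s1 : (1 < s)%R).
Variables p q : R.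
Hypotheses (p1 : (1 < p)%R) (q1 : (1 < q)%R).
Local Notation lint := (@lorentz_int R n p q).
Local Notation cap := (capacity G s).

Let q0 : (0 < q)%R. Proof. exact: lt_trans ltr01 q1. Qed.

Let q'0 : (0 < (conjexp q)^-1)%R.
Proof. by rewrite invr_gt0 divr_gt0// subr_gt0. Qed.

Lemma capacity_ge0 E : 0 <= cap E.
Proof. by apply: le_ereal_inf_tmp => _ [f _ <-]; exact: poweR_ge0. Qed.

Lemma le_capacity E F : E `<=` F -> cap E <= cap F.
Proof.
move=> EF; apply: ereal_inf_le_tmp => _ [f [mf f0 fF] <-]; exists f => //.
by split => // x /EF /fF.
Qed.

Lemma capacity0_lebn E : cap E = 0 -> lambda E = 0.
Proof.
move=> E0; have [K K0 hK] := lebn_le_capacity hG s1.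
by apply/eqP; rewrite eq_le outer_measure_ge0 andbT (le_trans (hK E))// E0 mule0.
Qed.

(** If [E] has capacity 0, the block inequality is void, because 0 * +oo = 0, and finiteness comes
    from [b] being 0 a.e.; otherwise the positive factor excludes an infinite quasi-norm. *)
Lemma block_lorentz_int b : is_block G s p q b -> lint b < +oo.
Proof.
move=> [mb [E [bE bsub hb]]]; have [E0|E0] := eqVneq (cap E) 0.
  rewrite lorentz_int_ae0// ?ltry//.
  apply: negligibleS (lebn_null (capacity0_lebn E0)) => x /= bx.
  by apply: bsub => /=; apply/eqP.
apply/(lorentz_lty p1 q1); rewrite ltey; apply/negP => /eqP ly; move: hb.
by rewrite ly gt0_muley ?leye_eq// poweR_gt0// lt_neqAle eq_sym E0 capacity_ge0.
Qed.

Let bnd_fin (r : R) : exists2 a : R, (0 <= a)%R &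
  cap [set x : Rn | (`|x| <= r)%R] `^ (conjexp q)^-1 = a%:E.
Proof.
exists (fine (cap [set x : Rn | (`|x| <= r)%R] `^ (conjexp q)^-1)).
  by rewrite fine_ge0// poweR_ge0.
rewrite fineK// ge0_fin_numE ?poweR_ge0// poweR_lty//.
exact: (capacity_bounded hG s1).
Qed.

(** The capacity of the ball enters as a fixed factor [a], so [d] serves all functions supported
    there; [e / (a + 1)] is the size that the factor [a / e] brings below 1. *)
Lemma is_block_scaled (r e : R) : (0 < e)%R ->
  exists2 d : R, (0 < d)%R & forall F, lebesgue_measurable F ->
    (forall x, (r < `|x|)%R -> F x = 0) -> lint F <= d%:E ->
    is_block G s p q (fun x => e^-1%:E * F x).
Proof.
move=> e0; have [a a0 ha] := bnd_fin r.
have [|d d0 hd] := @lorentz_small R n p q p1 q1 (e / (a + 1))%R.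
  by rewrite divr_gt0// ltr_wpDl.
exists d => // F' mF' zF' /hd lF'; split; first exact: measurable_funeM.
exists [set x | (`|x| <= r)%R]; split.
- exists r; split => [|M rM x /= xr]; first exact: num_real.
  exact: le_trans xr (ltW rM).
- move=> x /= Fx; rewrite leNgt; apply/negP => /zF' F0.
  by move: Fx; rewrite F0 mule0 eqxx.
- rewrite ha lorentzZ ?invr_gt0//.
  apply: (@le_trans _ _ (a%:E * (e^-1%:E * (e / (a + 1))%:E))).
    apply: lee_wpmul2l; first by rewrite lee_fin.
    by apply: lee_wpmul2l lF'; rewrite lee_fin invr_ge0 ltW.
  rewrite -!EFinM lee_fin mulKf ?gt_eqF// ler_pdivrMr ?ltr_wpDl//.
  by rewrite mul1r lerDl.
Qed.

Lemma block_approximation b e : (0 < e)%R -> is_block G s p q b ->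
  exists2 g : Rn -> R, Cc g & is_block G s p q (fun x => e^-1%:E * (b x - (g x)%:E)).
Proof.
move=> e0 bb; have bfin := block_lorentz_int bb.
have [mb [E [[r [_ hr]] bsub _]]] := bb.
(* The bound in [bounded_set] holds for radii strictly above [r], hence one extra unit; the collar
   of the approximation adds another, whence [r + 1 + 1]. *)
have zb x : (r + 1 < `|x|)%R -> b x = 0.
  move=> rx; apply/eqP/negPn/negP => /bsub /(hr (r + 1)%R) /=.
  by rewrite ltrDl ltr01 leNgt rx => /(_ isT).
have [d d0 hd] := is_block_scaled (r + 1 + 1) e0.
have d'0 : (0 < d / (2 * (2 `^ (q / p) * 2 `^ q)))%R.
  by rewrite divr_gt0// !mulr_gt0// powR_gt0.
pose A (k : nat) : set Rn := [set x | k%:R%:E < `|b x|].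
have mab : measurable_fun [set: Leb] ((fun x : Rn => `|b x|) : Leb -> \bar R).
  exact: measurableT_comp mb.
have mA k : (@measurable _ Leb) (A k).
  by have := @emeasurable_fun_o_infty _ Leb R setT _ measurableT mab k%:R%:E; rewrite setTI.
(* The intersection is the set where [b] is infinite. *)
have A0 : lambda (\bigcap_k A k) = 0.
  rewrite -(negligible_lebn (lorentz_int_fin_num p1 q1 bfin)).
  congr lebn; apply/seteqP; split => x /=.
    move=> h bx; have bE : b x = (fine (b x))%:E by rewrite fineK.
    have := h (Num.truncn `|fine (b x)|).+1 I; rewrite /A /= bE abse_EFin lte_fin.
    by apply/negP; rewrite -leNgt; exact/ltW/truncnS_gt.
  by rewrite /A => h k _ /=; move: h; case: (b x) => [t /(_ isT)//| |] _; rewrite /= ltry.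
have ndA k : A k.+1 `<=` A k.
  by move=> x; apply: le_lt_trans; rewrite lee_fin ler_nat.
have [k hk] := lorentz_int_truncate p1 q1 mb bfin mA ndA A0 d'0.
pose h x := fine ((b \_ (~` A k)) x).
have hE x : (h x)%:E = (b \_ (~` A k)) x.
  rewrite fineK// /patch; case: ifPn => // /set_mem; rewrite /A /= => /negP.
  by rewrite -leNgt; case: (b x).
have mh : measurable_fun [set: Leb] (h : Leb -> R).
  apply/measurable_EFinP; rewrite (_ : EFin \o h = b \_ (~` A k)); last exact/funext.
  apply/(measurable_restrictT _ _).1; first exact: measurableC.
  exact: measurable_funTS.
have zh : vanishes_off (r + 1) h.
  by move=> x rx; rewrite /h /patch zb//; case: ifP.
have bh x : (`|h x| <= k%:R)%R.
  rewrite -lee_fin -abse_EFin hE /patch; case: ifPn => [/set_mem|_].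
    by rewrite /A /= => /negP; rewrite -leNgt.
  by rewrite abse0 lee_fin.
have [g [cg zg lg]] := approximable_bounded p1 q1 mh zh bh d'0.
have Cg := Cc_vanishes_off cg zg.
exists g; first exact: Cg.
apply: (hd (fun x => b x - (g x)%:E)).
- exact: emeasurable_funB mb (Cc_measurable Cg).
- by move=> x rx; rewrite zb ?zg ?sube0//; apply: lt_trans rx; rewrite ltrDl.
- apply: (lorentz_intD_small p1 q1 _ hk lg).
  apply: aeW => x; rewrite EFinB hE /patch.
  case: ifPn => xA; case: ifPn => xA'.
  + by move: xA xA'; rewrite !inE.
  + by rewrite sub0e abseN; exact: lee_abs_sub.
  + by rewrite abse0 add0e.
  + by move: xA xA'; rewrite !notin_setE /= => h1 /(_ h1).
Qed.

Lemma Cc_block_space (g : Rn -> R) : Cc g -> block_space G s p q (EFin \o g).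
Proof.
move=> cg; split; first exact: Cc_measurable.
have [r hr] := Cc_vanishesP cg.
have [a a0 ha] := bnd_fin r.
have lfin : lorentz p q (EFin \o g) < +oo by apply/lorentz_lty => //; exact: Cc_lorentz_int.
have [L L0 hL] : exists2 L : R, (0 <= L)%R & lorentz p q (EFin \o g) = L%:E.
  have l0 : 0 <= lorentz p q (EFin \o g).
    by rewrite lorentzE// mule_ge0 ?lee_fin ?powR_ge0// poweR_ge0.
  exists (fine (lorentz p q (EFin \o g))); first exact: fine_ge0.
  by rewrite fineK// ge0_fin_numE.
(* One term suffices: g = c * (g / c), and [c] exceeds the product of the capacity factor and the
   quasi-norm of [g]. *)
pose c := (a * L + 1)%R; have c0 : (0 < c)%R by rewrite ltr_wpDl// mulr_ge0.
exists (fun k => if k is 0%N then c else 0%R), (fun _ x => (c^-1 * g x)%:E).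
have sum1 (u : nat -> \bar R) m : (forall k, u k.+1 = 0) ->
    \sum_(0 <= k < m.+1) u k = u 0%N.
  by move=> u0; rewrite big_nat_recl// big1 ?adde0.
split.
- rewrite (_ : limn _ = c%:E) ?ltry//; apply/cvg_lim => //.
  rewrite -cvg_shiftS (_ : [sequence _]_m = cst c%:E); first exact: cvg_cst.
  by apply/funext => m /=; rewrite sum1 => [|k]; rewrite ?normr0// gtr0_norm.
- move=> _; split; first by apply/Cc_measurable/CcZ.
  exists [set x | (`|x| <= r)%R]; split.
  + exists r; split => [|M rM x /= xr]; first exact: num_real.
    exact: le_trans xr (ltW rM).
  + move=> x /=; rewrite eqe => gx; rewrite leNgt; apply/negP => /hr g0.
    by move: gx; rewrite g0 mulr0 eqxx.
  + have -> : (fun x => (c^-1 * g x)%:E) = (fun x => c^-1%:E * (EFin \o g) x).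
      by apply/funext => x /=; rewrite EFinM.
    rewrite ha (lorentzZ p1 q1 (EFin \o g)) ?invr_gt0// hL -!EFinM lee_fin.
    by rewrite mulrCA mulrC ler_pdivrMr// mul1r lerDl.
- apply: aeW => x; split => //=.
  rewrite -cvg_shiftS (_ : [sequence _]_m = cst (g x)%:E); first exact: cvg_cst.
  apply/funext => m /=; rewrite sum1 => [|k]; last by rewrite mul0e.
  by rewrite -EFinM mulVKf ?gt_eqF.
Qed.

Lemma block_space_approximation f e : (0 < e)%R -> block_space G s p q f ->
  exists2 g : Rn -> R, Cc g & block_norm G s p q (fun x => f x - (g x)%:E) < e%:E.
Proof.
move=> e0 [mf [l [b [lfin bb fE]]]].
have l0 k : 0 <= `|l k|%:E by rewrite lee_fin.
have S0 : 0 <= \sum_(0 <= k <oo) `|l k|%:E by exact: nneseries_ge0.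
pose S := fine (\sum_(0 <= k <oo) `|l k|%:E).
have SE : \sum_(0 <= k <oo) `|l k|%:E = S%:E by rewrite fineK// ge0_fin_numE.
have S0' : (0 <= S)%R by rewrite fine_ge0.
have /(_ predT)/= := @nneseries_tail_cvg R (fun k => `|l k|%:E).
move=> /(_ lfin (fun k _ => l0 k)) tail.
have e20 : (0 < e / 2)%R by rewrite divr_gt0.
have /tail[m _ /(_ m (leqnn m))/= hm] : nbhs (0 : \bar R) [set y | y < (e / 2)%:E].
  by apply: open_nbhs_nbhs; split; [exact: open_ereal_lt_ereal|rewrite /= lte_fin].
(* Replacing the leading blocks then costs at most [e' * S], less than [e / 2]; the tail takes the
   other half. *)
pose e' := (e / (2 * (S + 1)))%R.
have e'0 : (0 < e')%R by rewrite divr_gt0// mulr_gt0// ltr_wpDl.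
have /choice[g hg] k : exists g : Rn -> R, Cc g /\
    is_block G s p q (fun x => e'^-1%:E * (b k x - (g x)%:E)).
  by have [g cg bg] := block_approximation e'0 (bb k); exists g.
exists (fun x => \sum_(0 <= k < m) l k * g k x)%R.
  by apply: Cc_sum => k; have [] := hg k.
(* A decomposition of f - g: each leading block gives way to its error, which is e' times a block,
   and the tail is kept. *)
pose l' k := (if (k < m)%N then l k * e' else l k)%R.
pose b' k x := if (k < m)%N then e'^-1%:E * (b k x - (g k x)%:E) else b k x.
have l'0 k : 0 <= `|l' k|%:E by rewrite lee_fin.
have sum_l' : \sum_(0 <= k <oo) `|l' k|%:E < e%:E.
  rewrite (nneseries_split 0 m)//= add0n.
  rewrite (_ : \sum_(m <= k <oo) `|l' k|%:E = \sum_(m <= k <oo) `|l k|%:E); last first.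
    congr (limn _); apply/funext => M; apply: eq_big_nat => k /andP[mk _].
    by rewrite /l' ltnNge mk.
  have hs : (\sum_(0 <= k < m) `|l k| <= S)%R.
    rewrite -lee_fin -sumEFin -SE.
    exact: (@nneseries_lim_ge R (fun k => `|l k|%:E) xpredT 0 m).
  have -> : \sum_(0 <= k < m) `|l' k|%:E = ((\sum_(0 <= k < m) `|l k|) * e')%:E.
    rewrite mulr_suml -sumEFin; apply: eq_big_nat => k /andP[_ km].
    by rewrite /l' km normrM (gtr0_norm e'0).
  rewrite [e]splitr EFinD; apply: lee_ltD => //; rewrite lee_fin.
  apply: le_trans (ler_wpM2r (ltW e'0) hs) _.
  have -> : (e / 2 = (S + 1) * e')%R.
    by rewrite /e'; field; rewrite gt_eqF// ltr_wpDl.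
  by rewrite ler_pM2r// lerDl.
have sl := lt_le_trans sum_l' (leey _).
apply: (le_lt_trans _ sum_l'); apply: ereal_inf_lbound; exists l', b'; split; last by [].
split.
- exact: sl.
- move=> k; have [km|mk] := ltnP k m.
    have -> : b' k = (fun x => e'^-1%:E * (b k x - (g k x)%:E)).
      by apply/funext => x; rewrite /b' km.
    by have [] := hg k.
  have -> : b' k = b k by apply/funext => x; rewrite /b' ltnNge mk.
  exact: bb.
(* All blocks are finite off one common null set, where sums and differences may be rearranged as
   real numbers. *)
- have bfin : {ae lambda, forall x k, b k x \is a fin_num}.
    apply/ae_foralln => k; apply: (lorentz_int_fin_num p1 q1).
    exact: block_lorentz_int (bb k).
  apply: lebn_aeS2 fE bfin => x [ffin cf] bxfin; split.
    by rewrite fin_numD ffin.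
  apply: (@cvg_trans _ ((fun M => \sum_(0 <= k < M) (l k)%:E * b k x -
      (\sum_(0 <= k < m) l k * g k x)%R%:E) @ \oo)); last first.
    have h1 : f x +? - (\sum_(0 <= k < m) l k * g k x)%R%:E by rewrite fin_num_adde_defl.
    have h2 : cst (\sum_(0 <= k < m) l k * g k x)%R%:E @ \oo -->
        (\sum_(0 <= k < m) l k * g k x)%R%:E by exact: cvg_cst.
    exact: cvgeB h1 cf h2.
  (* From [m] terms on, the new partial sum is the old one minus the whole approximant. *)
  apply: near_eq_cvg; exists m => // M /= mM.
  pose be k := fine (b k x).
  have bE k : b k x = (be k)%:E by rewrite /be fineK.
  have b'E k : (l' k)%:E * b' k x = (l k * be k - (if (k < m)%N then l k * g k x else 0))%:E.
    rewrite /l' /b' bE; case: ifPn => _; rewrite -?EFinB -!EFinM ?subr0//.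
    by congr EFin; field; rewrite gt_eqF.
  have -> : \sum_(0 <= k < M) (l' k)%:E * b' k x =
      (\sum_(0 <= k < M) (l k * be k - (if (k < m)%N then l k * g k x else 0)))%:E.
    by rewrite -sumEFin; apply: eq_bigr => k _; exact: b'E.
  have -> : \sum_(0 <= k < M) (l k)%:E * b k x = (\sum_(0 <= k < M) l k * be k)%:E.
    by rewrite -sumEFin; apply: eq_bigr => k _; rewrite bE.
  rewrite -EFinB sumrB; congr (_ - _)%:E.
  rewrite [RHS](big_cat_nat _ mM)//= [X in (_ + X)%R]big_nat_cond [X in (_ + X)%R]big1 ?addr0.
    by apply: eq_big_nat => k /andP[_ ->].
  by move=> k /andP[/andP[mk _] _]; rewrite ltnNge mk.
Qed.

End block_space.

(** * Euclidean balls against sup-norm balls *)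

Section euclidean_balls.
Context {R : realType} {n : nat}.
Local Notation Rn := 'rV[R]_n.
Local Notation Leb := (leb_space R n).
Local Notation lambda := (@lebn R n).

Lemma norm_le_enorm (z : Rn) (r : R) : (enorm z < r)%R -> (`|z| <= r)%R.
Proof.
move=> zr; have r0 : (0 < r)%R by apply: le_lt_trans zr; exact: sqrtr_ge0.
apply/ltW/coord_norm_lt => // i; apply: le_lt_trans zr.
rewrite /enorm -sqrtr_sqr; apply: ler_wsqrtr.
rewrite /edot (bigD1 i)//= -expr2 lerDl.
by apply: sumr_ge0 => j _; rewrite -expr2 sqr_ge0.
Qed.

(** A sum of n squares, each at most 1/(n+1), stays below 1; this crude radius also covers n = 0. *)
Lemma enorm_small (z : Rn) : (`|z| < n.+1%:R^-1)%R -> (enorm z < 1)%R.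
Proof.
move=> /coord_norm_lt; rewrite invr_gt0 => /(_ (ltr0Sn _ _)) hz.
rewrite /enorm -[ltRHS]sqrtr1 ltr_sqrt//.
apply: (@le_lt_trans _ _ (\sum_(i < n) n.+1%:R^-1)%R).
  apply: ler_sum => i _.
  have h1 : (z 0 i * z 0 i = `|z 0 i| * `|z 0 i|)%R by rewrite -normrM ger0_norm// -expr2 sqr_ge0.
  rewrite h1 -[leRHS]mulr1; apply: ler_pM => //; first exact/ltW/hz.
  apply/ltW/(lt_le_trans (hz i)); rewrite invf_le1// ler1n//.
rewrite sumr_const card_ord -[(_ *+ n)%R]mulr_natr mulrC ltr_pdivrMr// mul1r ltr_nat.
exact: ltnSn.
Qed.

Lemma eball_measurable (x : Rn) (r : R) : (@measurable _ Leb) (eball x r).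
Proof.
have mc i : measurable_fun [set: Leb] ((fun y : Rn => ((y - x) 0 i)%R) : Leb -> R).
  under eq_fun do rewrite !mxE.
  exact: measurable_funB (measurable_coord i) (measurable_cst _).
have md : measurable_fun [set: Leb] ((fun y : Rn => edot (y - x) (y - x)) : Leb -> R).
  by apply: measurable_sum => i; exact: measurable_funM.
have ms : measurable_fun [set: R] (@Num.sqrt R).
  by apply: continuous_measurable_fun; exact: sqrt_continuous.
have me := measurableT_comp ms md.
have -> : eball x r = [set: Leb] `&` (fun y : Rn => enorm (y - x)) @^-1` `]-oo, r[%classic.
  by apply/seteqP; split => y; rewrite /eball /= in_itv/= => // -[].
exact: me measurableT _ (measurable_itv _).
Qed.

Lemma ball_measurable (x : Rn) (r : R) : (@measurable _ Leb) [set y | (`|y - x| < r)%R].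
Proof.
have [r0|r0] := ltP 0%R r; last first.
  rewrite (_ : [set y | _] = set0) //; apply/seteqP; split => // y /= /lt_le_trans.
  by move=> /(_ _ r0); rewrite normr_lt0.
rewrite (_ : [set y | _] = [set y : Rn | forall i, (`|y 0 i - x 0 i| < r)%R]).
  exact: cube_measurable.
apply/seteqP; split => y /=.
  by move=> /(coord_norm_lt _ r0) h i; have := h i; rewrite !mxE.
by move=> h; apply/coord_norm_lt => // i; have := h i; rewrite !mxE.
Qed.

End euclidean_balls.

(** * Weights: finiteness and lower bounds *)

Section weights.
Context {R : realType} {n : nat}.
Local Notation Rn := 'rV[R]_n.
Local Notation Leb := (leb_space R n).
Local Notation lambda := (@lebn R n).
Implicit Types w : Rn -> \bar R.
Local Notation cube r := [set x : Rn | (`|x| <= r)%R].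

Lemma cube_compact (r : R) : compact (cube r).
Proof.
apply: bounded_closed_compact.
  exists r; split => [|M rM x /= xr]; first exact: num_real.
  exact: le_trans xr (ltW rM).
have : closed ((fun x : Rn => `|x|%R) @^-1` [set t : R | (t <= r)%R]).
  by apply: closed_comp => [x _|]; [exact: norm_continuous|exact: closed_le].
exact.
Qed.

Lemma weight_fin_num w : is_weight w -> {ae lambda, forall x, w x \is a fin_num}.
Proof.
move=> [mw w0 wK _].
have h k : {ae lambda, forall x, cube k%:R x -> w x \is a fin_num}.
  apply: (@integrable_ae _ Leb R lambda (cube k%:R) (closed_ball0_measurable _) w).
  apply/integrableP; split; first exact: measurable_funTS.
  under eq_integral do rewrite (gee0_abs (w0 _)).
  by apply: wK; exact: cube_compact.
have hh : {ae lambda, forall x k, cube k%:R x -> w x \is a fin_num} by exact/ae_foralln.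
apply: lebn_aeS hh => x hx.
by apply: (hx (Num.truncn `|x|%R).+1); exact/ltW/truncnS_gt.
Qed.

Variables (alpha : R) (G : Rn -> R).
Hypothesis hG : is_bessel_kernel alpha G.

Lemma weight_integral_gt0 w (x : Rn) (r : R) : is_weight w -> (0 < r)%R ->
  0 < \int[lambda]_(y in [set y | (`|y - x| < r)%R]) `|w y|.
Proof.
move=> [mw w0 _ wpos] r0; set D := [set y | _].
have mD : (@measurable _ Leb) D by exact: ball_measurable.
rewrite lt_neqAle eq_sym integral_ge0 ?andbT//.
apply/negP => /eqP /(iffLR (ae_eq_integral_abs lambda mD (measurable_funTS mw))) h.
have : lambda D = 0.
  apply: negligible_lebn; apply: negligibleS (negligibleU wpos h) => y Dy.
  have [wy|nwy] := pselect (0 < w y); last by left.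
  by right => /(_ Dy) wy0; move: wy; rewrite wy0 ltxx.
by apply/eqP; rewrite gt_eqF// (lebn_ball_gt0 hG).
Qed.

(** At almost every x, C w(x) dominates the mean of w over the unit ball at x. Each such mean is
    positive, and a positive lower bound persists at nearby centres, so compactness makes it uniform
    on the cube. *)
Lemma A1loc_lower w (r : R) : in_A1loc w ->
  exists2 k : R, (0 < k)%R & {ae lambda, forall x, (`|x| <= r)%R -> k%:E <= w x}.
Proof.
move=> [ww [C [C0 hC]]].
have [mw w0 _ _] := ww.
pose rho : R := n.+1%:R^-1%R.
have rho0 : (0 < rho)%R by rewrite invr_gt0.
pose I (x : Rn) := \int[lambda]_(y in eball x 1) `|w y|.
have [eta eta0 heta] : exists2 eta : R, (0 < eta)%R & forall x, cube r x -> eta%:E <= I x.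
  have rho2 : (0 < rho / 2)%R by rewrite divr_gt0.
  have maw : measurable_fun [set: Leb] ((fun y => `|w y|) : Leb -> \bar R).
    exact: measurableT_comp mw.
  (* The parameter tending to 0 from the right is the threshold; the near-covering form of
     compactness yields one threshold for the whole cube. *)
  have := (iffLR (compact_near_coveringP _)) (@cube_compact r) R 0^'+
    (fun i x => i%:E <= I x) _.
  case=> [x xr|i0 /= i00 hi].
    (* Unit Euclidean balls centred within [rho / 2] of [x] all contain this sup-norm ball, so its
       integral serves a whole neighbourhood. *)
    pose m := \int[lambda]_(y in [set y | (`|y - x| < rho / 2)%R]) `|w y|.
    have m0 : 0 < m by exact: weight_integral_gt0.
    have [i0 i00 im] : exists2 i0 : R, (0 < i0)%R & i0%:E <= m.
      move: m0; case: m => [t t0|_|//]; first by exists t.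
      by exists 1%R => //; rewrite leey.
    exists (ball x (rho / 2), [set i | (i <= i0)%R]) => /=.
      by split; [exact: nbhsx_ballx|exact: nbhs_right_le].
    move=> [x' i] [/= xx' ii0]; apply: (@le_trans _ _ m).
      by apply: le_trans im; rewrite lee_fin.
    apply: (@ge0_subset_integral _ Leb R lambda _ _ (ball_measurable _ _)
      (eball_measurable _ _) _ (measurable_funTS maw)).
    - by move=> y _; exact: abse_ge0.
    - move=> y /= yx; apply: enorm_small; rewrite -(subrKA x) (splitr n.+1%:R^-1).
      apply: (le_lt_trans (ler_normD _ _)); apply: ltrD => //.
      by move: xx'; rewrite -ball_normE.
  have i02 : (0 < i0 / 2)%R by rewrite divr_gt0.
  exists (i0 / 2)%R => // x xr; apply: (hi (i0 / 2)%R) => //=.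
  rewrite sub0r normrN gtr0_norm//.
  by rewrite ltr_pdivrMr// ltr_pMr// ltr1n.
(* Unit balls centred in the cube lie in the cube of radius [r + 1], so [v] bounds their volumes. *)
pose v := fine (lambda (cube (r + 1))).
have vE : lambda (cube (r + 1)) = v%:E by rewrite fineK// ge0_fin_numE// lebn_bounded.
have v0 : (0 <= v)%R by exact: fine_ge0.
have v1 : (0 < v + 1)%R by rewrite ltr_wpDl.
exists (eta / (C * (v + 1)))%R; first by rewrite divr_gt0// mulr_gt0.
apply: lebn_aeS hC => x hx xr.
have bv : lambda (eball x 1) <= v%:E.
  rewrite -vE; apply: le_lebn => y /norm_le_enorm yx /=.
  rewrite -(subrK x y); apply: (le_trans (ler_normD _ _)).
  by rewrite addrC lerD.
have b0 : 0 < lambda (eball x 1).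
  apply: lt_le_trans (lebn_ball_gt0 hG x rho0) _.
  by apply: le_lebn => y /= /enorm_small.
have bE : lambda (eball x 1) = (fine (lambda (eball x 1)))%:E.
  by rewrite fineK// ge0_fin_numE// (le_lt_trans bv)// ltry.
have h1 : ((v + 1)^-1)%:E * eta%:E <= C%:E * w x.
  apply: le_trans hx; apply: (@le_trans _ _ ((fine (lambda (eball x 1)))^-1%:E * I x)).
    apply: lee_pmul; rewrite ?lee_fin ?invr_ge0 ?(ltW v1) ?(ltW eta0)//; last exact: heta.
    move: bv b0; rewrite bE lee_fin lte_fin => bv b0.
    by rewrite lef_pV2 ?posrE//; apply: le_trans bv _; rewrite lerDl.
  apply: ereal_sup_ubound; exists 1%R; last by [].
  by rewrite /= in_itv/= ltr01 lexx.
move: h1; have := w0 x; case: (w x) => [t t0|_ _|//]; last exact: leey.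
rewrite -!EFinM !lee_fin => h1.
by rewrite ler_pdivrMr ?mulr_gt0// mulrCA mulrA -ler_pdivrMr// mulrC.
Qed.

End weights.

(** * Multiplying a weight by a constant *)

Section weight_scaling.
Context {R : realType} {n : nat}.
Local Notation Rn := 'rV[R]_n.
Local Notation Leb := (leb_space R n).
Local Notation lambda := (@lebn R n).
Variables (G : Rn -> R) (s t : R).
Hypothesis t0 : (0 < t)%R.
Implicit Types w : Rn -> \bar R.

(** Scaling does not increase the local A_1 constant, so it can bring the weights of
    [is_A1loc_constant], whose [cap_norm] is comparable with a capacity, to [cap_norm] at most 1. *)
Lemma cap_norm_scale w : cap_norm G s (fun x => t%:E * w x) = t%:E * cap_norm G s w.
Proof.
rewrite /cap_norm (integral_half_line_scale t0).
- congr (_ * _); apply: eq_integral => u _; congr (capacity G s _).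
  by apply/seteqP; split => x /=; rewrite EFinM lte_pmul2l ?lte_fin.
- apply: nonincreasing_emeasurable => // u v uv; apply: le_capacity => x /=.
  by apply: le_lt_trans; rewrite lee_fin.
- by move=> u; exact: capacity_ge0.
Qed.

Lemma is_weight_scale w : is_weight w -> is_weight (fun x => t%:E * w x).
Proof.
move=> [mw w0 wK wpos]; split.
- exact: measurable_funeM.
- by move=> x; rewrite mule_ge0// lee_fin ltW.
- move=> K cK; have mK : (@measurable _ Leb) K.
    exact: closed_measurable_leb (compact_closed (@norm_hausdorff R Rn) cK).
  rewrite (@ge0_integralZl_EFin _ Leb R lambda K mK w (fun x _ => w0 x)
    (measurable_funTS mw) t (ltW t0)).
  by apply: lte_mul_pinfty; rewrite ?lee_fin ?(ltW t0)//; exact: wK.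
- by apply: lebn_aeS wpos => x wx; rewrite mule_gt0 ?lte_fin.
Qed.

Lemma A1loc_bound_scale w (C : R) : is_weight w ->
  A1loc_bound w C -> A1loc_bound (fun x => t%:E * w x) C.
Proof.
move=> [mw w0 _ _] [C0 hC]; split => //; apply: lebn_aeS hC => x hx.
rewrite muleCA; apply: (@le_trans _ _ (t%:E * local_maximal w x)); last first.
  by apply: lee_wpmul2l hx; rewrite lee_fin ltW.
apply: ge_ereal_sup => _ [r r01 <-].
have maw : measurable_fun [set: Leb] ((fun y => `|w y|) : Leb -> \bar R).
  exact: measurableT_comp mw.
under eq_integral do rewrite abseM abse_EFin (gtr0_norm t0).
rewrite (@ge0_integralZl_EFin _ Leb R lambda _ (eball_measurable x r) _
    (fun x _ => abse_ge0 _) (measurable_funTS maw) t (ltW t0)).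
rewrite muleCA; apply: lee_wpmul2l; first by rewrite lee_fin ltW.
by apply: ereal_sup_ubound; exists r.
Qed.

Lemma in_A1loc_scale w : in_A1loc w -> in_A1loc (fun x => t%:E * w x).
Proof.
move=> [ww [C hC]]; split; first exact: is_weight_scale.
by exists C; exact: A1loc_bound_scale.
Qed.

Lemma A1loc_const_scale w : is_weight w ->
  A1loc_const (fun x => t%:E * w x) <= A1loc_const w.
Proof.
move=> ww; apply: ereal_inf_le_tmp => _ [C hC <-]; exists C => //.
exact: A1loc_bound_scale.
Qed.

End weight_scaling.

(** * Density in N^{p,q} *)

Section N_space.
Context {R : realType} {n : nat}.
Local Notation Rn := 'rV[R]_n.
Local Notation Leb := (leb_space R n).
Local Notation lambda := (@lebn R n).
Variables (alpha s c : R) (G : Rn -> R).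
Hypotheses (hG : is_bessel_kernel alpha G) (s1 : (1 < s)%R).
Hypothesis hc : is_A1loc_constant G s c.
Variables p q : R.
Hypotheses (p1 : (1 < p)%R) (q1 : (1 < q)%R).
Local Notation lint := (@lorentz_int R n p q).
Local Notation cap := (capacity G s).
Local Notation cube r := [set x : Rn | (`|x| <= r)%R].
Local Notation r' := (conjexp q)^-1%R.

Let q0 : (0 < q)%R. Proof. exact: lt_trans ltr01 q1. Qed.

Let q'0 : (0 < r')%R.
Proof. by rewrite invr_gt0 divr_gt0// subr_gt0. Qed.

(** The exponent is negative, so a lower bound for the weight becomes an upper bound. Finiteness
    matters: by convention +oo to a nonzero power is +oo. *)
Lemma poweRN_le (k : R) (w : \bar R) : (0 < k)%R -> k%:E <= w -> w \is a fin_num ->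
  0 <= w `^ (- r') <= (k `^ (- r'))%:E.
Proof.
move=> k0; case: w => // t; rewrite lee_fin => kt _.
rewrite poweR_EFin !lee_fin powR_ge0/= !powRN lef_pV2 ?posrE ?powR_gt0//.
  by apply: ge0_ler_powR; rewrite ?nnegrE ?(ltW q'0) ?(ltW k0)// (le_trans (ltW k0)).
exact: lt_le_trans kt.
Qed.

(** On E, off a null set, V^E >= 1, hence (V^E)^delta >= 1, and the negative power of the normalised
    weight is at most a constant: the weighted function is dominated by a multiple of [g]. *)
Lemma Cc_N_space (g : Rn -> R) : Cc g -> N_space G s c p q (EFin \o g).
Proof.
move=> cg; split; first exact: Cc_measurable.
have [r hr] := Cc_vanishesP cg.
(* With radius at least 1, [E] contains a ball of positive measure and thus has positive
   capacity. *)
pose E := cube (Num.max r 1).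
have capE : 0 < cap E < +oo.
  rewrite (capacity_bounded hG s1) andbT lt_neqAle capacity_ge0 andbT eq_sym.
  apply/eqP => /(capacity0_lebn hG s1) E0.
  have := lebn_ball_gt0 hG 0%R ltr01; rewrite ltNge -E0 => /negP; apply.
  by apply: le_lebn => x; rewrite /E /= subr0 le_max => /ltW ->; rewrite orbT.
have [_ [delta [C [delta0 C0 hE]]]] := hc.
have [mu [_ [Z Z0 VZ] _ _] [[W0 Wfin] AW /andP[_ WC] Wc]] := hE E capE.
set W := fun x => potential G s mu x `^ delta in W0 Wfin AW WC Wc.
have [kE kE0 kEE] : exists2 k : R, (0 < k)%R & cap E = k%:E.
  move: capE => /andP[cE0 cEy]; exists (fine (cap E)).
    by rewrite fine_gt0// cE0.
  by rewrite fineK// ge0_fin_numE// ltW.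
(* By the upper bound [C * cap E] on its [cap_norm], [W] multiplied by this [t] is admissible. *)
pose t := (C * kE)^-1%R.
have t0 : (0 < t)%R by rewrite invr_gt0 mulr_gt0.
pose w x := t%:E * W x.
have ww := is_weight_scale t0 AW.1.
apply: (@le_lt_trans _ _ (lorentz p q (fun x => (EFin \o g) x * w x `^ (- r')))).
  apply: ereal_inf_lbound; exists w => //; split.
  - split; first by move=> x; rewrite mule_ge0 ?W0// lee_fin ltW.
    by rewrite cap_norm_scale// lte_mul_pinfty// lee_fin ltW.
  - exact: in_A1loc_scale.
  - rewrite cap_norm_scale//; apply: (@le_trans _ _ (t%:E * (C%:E * cap E))).
      by apply: lee_wpmul2l; [rewrite lee_fin ltW|exact: WC].
    by rewrite kEE -!EFinM lee_fin /t mulVf// gt_eqF// mulr_gt0.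
  - exact: le_trans (A1loc_const_scale t0 AW.1) Wc.
apply/(lorentz_lty p1 q1).
pose v := (t `^ (- r'))%R.
have v0 : (0 < v)%R by exact: powR_gt0.
apply: (@le_lt_trans _ _ ((2 `^ (q / p) * 2 `^ q)%:E *
    (lint (fun x => v%:E * (EFin \o g) x) + lint (cst 0)))).
  apply: (lorentz_intD p1 q1).
  have hZ : {ae lambda, forall x, ~ Z x}.
    by apply: negligibleS (lebn_null (capacity0_lebn hG s1 Z0)) => x /= /contrapT.
  apply: lebn_aeS2 (weight_fin_num ww) hZ => x wx nZ.
  rewrite -[(EFin \o g) x]/((g x)%:E) abse0 adde0 !abseM !abse_EFin (gtr0_norm v0) muleC.
  have [xr|/hr/= ->] := leP `|x|%R r; last by rewrite normr0 !mule0.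
  apply: lee_wpmul2r; first by rewrite lee_fin.
  have Wx1 : 1 <= W x.
    have V1 : 1 <= potential G s mu x by apply: VZ; rewrite /E/= ?le_max ?xr.
    rewrite -(poweR1r delta); apply: gt0_ler_poweR => //; first exact: ltW.
      by rewrite in_itv/= leey andbT.
    by rewrite in_itv/= leey andbT (le_trans _ V1).
  have /andP[h1 h2] : 0 <= w x `^ (- r') <= v%:E.
    apply: poweRN_le => //; rewrite -[leLHS]mule1.
    by apply: lee_wpmul2l; [rewrite lee_fin ltW|exact: Wx1].
  by rewrite gee0_abs.
have l0 : lint (cst 0) = 0 by apply: (lorentz_int_ae0 p1 q1); apply: aeW.
rewrite (lorentz_intZ p1 q1)// l0 adde0.
rewrite muleA -EFinM; apply: lte_mul_pinfty => //; last exact: Cc_lorentz_int.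
by rewrite lee_fin !mulr_ge0// powR_ge0.
Qed.

(** A weight that makes the quasi-norm of [f] finite also serves for f - g. The truncation sets are
    defined by the size of [f], which has to become bounded, while the truncation error is measured
    on [F]. *)
Lemma N_space_approximation f e : (0 < e)%R -> N_space G s c p q f ->
  exists2 g : Rn -> R, Cc g & N_norm G s c p q (fun x => f x - (g x)%:E) < e%:E.
Proof.
move=> e0 [mf /ereal_inf_lt[_ [w [wL wA wn wc] <-] wfin]].
pose F x := f x * w x `^ (- r').
have [ww _] := wA; have [mw w0 _ wpos] := ww.
have mF : lebesgue_measurable F.
  have mwr : lebesgue_measurable (fun x => w x `^ (- r')).
    exact: (measurableT_comp (measurable_poweR _) mw).
  exact: emeasurable_funM mf mwr.
have Ffin : lint F < +oo by apply/(lorentz_lty p1 q1).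
have wf := weight_fin_num ww.
(* Where [w] is positive so is its power, and [F] cannot be finite where [f] is infinite. *)
have ffin : {ae lambda, forall x, f x \is a fin_num}.
  have h1 := lorentz_int_fin_num p1 q1 Ffin.
  have h2 : {ae lambda, forall x, 0 < w x /\ w x \is a fin_num}.
    by apply: lebn_aeS2 wpos wf.
  apply: lebn_aeS2 h1 h2 => x Fx [wx wxf]; move: Fx; rewrite /F.
  have : 0 < w x `^ (- r') by exact: poweR_gt0.
  case: (f x) => // h.
    by rewrite gt0_mulye.
  by rewrite gt0_mulNye.
have [e20 e2e] : (0 < e / 2)%R /\ (e / 2 < e)%R by split; lra.
have [d d0 hd] := @lorentz_small R n p q p1 q1 _ e20.
pose d' := (d / (2 * (2 `^ (q / p) * 2 `^ q)))%R.
have d'0 : (0 < d')%R by rewrite divr_gt0// !mulr_gt0// powR_gt0.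
(* Unlike a block, [f] need not have bounded support, so space is truncated together with the
   values. *)
pose B (k : nat) : set Rn := [set x | (`|x| <= k%:R)%R] `&` [set x | `|f x| <= k%:R%:E].
pose A k := ~` B k.
have maf : measurable_fun [set: Leb] ((fun x : Rn => `|f x|) : Leb -> \bar R).
  exact: measurableT_comp mf.
have mB k : (@measurable _ Leb) (B k).
  apply: measurableI; first exact: closed_ball0_measurable.
  by have := @emeasurable_fun_infty_c _ Leb R setT _ measurableT maf k%:R%:E; rewrite setTI.
have mA k : (@measurable _ Leb) (A k) by exact: measurableC.
have A0 : lambda (\bigcap_k A k) = 0.
  apply: negligible_lebn; apply: negligibleS ffin => x h /= fx.
  have fE : f x = (fine (f x))%:E by rewrite fineK.
  pose k := (Num.truncn (Num.max `|x| `|fine (f x)|)%R).+1.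
  have kx : (Num.max `|x| `|fine (f x)| <= k%:R)%R by exact/ltW/truncnS_gt.
  apply: (h k I); move: kx; rewrite ge_max => /andP[k1 k2]; split => //=.
  by rewrite fE abse_EFin lee_fin.
have ndA k : A k.+1 `<=` A k.
  apply: subsetC => x [/= h1 h2]; split => /=.
    by apply: le_trans h1 _; rewrite ler_nat.
  by apply: le_trans h2 _; rewrite lee_fin ler_nat.
have [k hk] := lorentz_int_truncate p1 q1 mF Ffin mA ndA A0 d'0.
pose h x := fine ((f \_ (B k)) x).
have hE x : (h x)%:E = (f \_ (B k)) x.
  rewrite fineK// /patch; case: ifPn => // /set_mem[_] /=.
  by case: (f x).
have mh : measurable_fun [set: Leb] (h : Leb -> R).
  apply/measurable_EFinP; rewrite (_ : EFin \o h = f \_ (B k)); last exact/funext.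
  apply/(measurable_restrictT _ _).1; first exact: mB.
  exact: measurable_funTS.
have zh : vanishes_off k%:R h.
  by move=> x rx; rewrite /h /patch; case: ifPn => // /set_mem[/=]; rewrite leNgt rx.
have bh x : (`|h x| <= k%:R)%R.
  rewrite -lee_fin -abse_EFin hE /patch; case: ifPn => [/set_mem[]//|_].
  by rewrite abse0 lee_fin.
(* The approximant lives in the ball of radius k + 1; there the weight is a.e. at least [kap], and
   its negative power at most [v]. *)
have [kap kap0 hkap] := A1loc_lower hG (k%:R + 1)%R wA.
pose v := (kap `^ (- r'))%R.
have v0 : (0 < v)%R by exact: powR_gt0.
have vq0 : (0 < v `^ q)%R by exact: powR_gt0.
have [|g [cg zg lg]] := approximable_bounded p1 q1 mh zh bh (d := (d' / v `^ q)%R).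
  by rewrite divr_gt0.
have Cg := Cc_vanishes_off cg zg.
exists g; first exact: Cg.
apply: (@le_lt_trans _ _ (e / 2)%:E); last by rewrite lte_fin.
apply: (@le_trans _ _ (lorentz p q (fun x => (f x - (g x)%:E) * w x `^ (- r')))).
  by apply: ereal_inf_lbound; exists w.
apply: hd.
have l2 : lint (fun x => v%:E * (h x - g x)%:E) <= d'%:E.
  rewrite (lorentz_intZ p1 q1)//.
  apply: (@le_trans _ _ ((v `^ q)%:E * (d' / v `^ q)%:E)).
    by apply: lee_wpmul2l lg; rewrite lee_fin ltW.
  by rewrite -EFinM lee_fin mulrCA mulfV ?mulr1// gt_eqF.
(* The weighted error is at most |F| on the cut part plus v |h - g|: where [f] was cut, h = 0 and
   |g| = |h - g|. *)
apply: (lorentz_intD_small p1 q1 _ hk l2).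
have hw : {ae lambda, forall x, w x \is a fin_num /\ ((`|x| <= k%:R + 1)%R -> kap%:E <= w x)}.
  by apply: lebn_aeS2 wf hkap.
apply: lebn_aeS2 ffin hw => x fx [wx wk].
have u0 : 0 <= w x `^ (- r') by exact: poweR_ge0.
have [u uE] : exists u : R, w x `^ (- r') = u%:E.
  by exists (fine (w x `^ (- r'))); rewrite fineK// fin_num_poweR.
have u0' : (0 <= u)%R by rewrite -lee_fin -uE.
have uv : (`|x| <= k%:R + 1)%R -> (u <= v)%R.
  by move=> /wk kw; rewrite -lee_fin -uE; have /andP[] := poweRN_le kap0 kw wx.
have fE : f x = (fine (f x))%:E by rewrite fineK.
have hx : h x = if x \in B k then fine (f x) else 0%R.
  by rewrite /h /patch; case: ifP.
rewrite /patch /F uE fE; case: ifPn => xA.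
  have -> : h x = 0%R by rewrite hx memNset//; move: xA; rewrite inE.
  rewrite -?EFinB -!EFinM !abse_EFin -EFinD lee_fin.
  rewrite sub0r !normrM normrN (ger0_norm u0') (gtr0_norm v0).
  apply: (@le_trans _ _ ((`|fine (f x)| + `|g x|) * u)%R).
    by apply: ler_wpM2r => //; exact: ler_normB.
  rewrite mulrDl lerD2l mulrC; have [xk|/zg ->] := leP `|x|%R (k%:R + 1)%R.
    by apply: ler_wpM2r => //; exact: uv.
  by rewrite normr0 !mulr0.
have xB : x \in B k by move: xA; rewrite notin_setE => /contrapT /mem_set.
rewrite hx xB -?EFinB -!EFinM abse0 add0e !abse_EFin lee_fin.
rewrite !normrM (ger0_norm u0') (gtr0_norm v0) mulrC; apply: ler_wpM2r => //.
by apply: uv; move: xB => /set_mem[/= xk _]; apply: le_trans xk _; rewrite lerDl.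
Qed.

End N_space.

Local Close Scope ereal_scope.
Local Close Scope classical_set_scope.

Theorem proposition1p5 (R : realType) (n : nat) (alpha s : R)
    (halpha : 0 < alpha) (hs1 : 1 < s) (hsn : s <= n%:R / alpha)
    (G : 'rV[R]_n -> R) (hG : is_bessel_kernel alpha G)
    (c : R) (hc : is_A1loc_constant G s c)
    (p q : R) (hp : 1 < p) (hq : 1 < q) :
  Cc_dense (block_space G s p q) (block_norm G s p q) /\
  Cc_dense (N_space G s c p q) (N_norm G s c p q).
Proof.
split; split.
- by move=> g; exact: (Cc_block_space hG hs1 hp hq).
- by move=> f Bf e e0; exact: (block_space_approximation hG hs1 hp hq e0 Bf).
- by move=> g; exact: (Cc_N_space hG hs1 hc hp hq).
- by move=> f Nf e e0; exact: (N_space_approximation hG hp hq e0 Nf).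
Qed.
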